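(* Let $C_n$ be the (directed) $n$-cycle on vertex set $\{1,\ldots,n\}$, let $2\le t\le n$, and let $I_t(C_n)\subset k[x_1,\ldots,x_n]$ be its path ideal of length $t$, where $k$ is a field. Then $I_t(C_n)$ has a linear resolution if and only if $t=n-2$ or $t=n-1$. Moreover, the following conditions are equivalent: (a) $I_t(C_n)$ has a linear resolution; (b) $I_t(C_n)$ is a variable-decomposable ideal; (c) $I_t(C_n)$ has linear quotients.
   Context: For a directed graph $G$ on $\{1,\ldots,n\}$ and an integer $2\le t\le n$, a path of length $t$ is a sequence $i_1,\ldots,i_t$ of distinct vertices such that there are $t-1$ distinct directed edges $e_1,\ldots,e_{t-1}$ with $e_j$ going from $i_j$ to $i_{j+1}$. The path ideal $I_t(G)$ is generated by the monomials $\prod_{j=1}^t x_{i_j}$ over all paths $i_1,\ldots,i_t$ of length $t$ in $G$. Write $S=k[x_1,\ldots,x_n]$. An ideal $I$ generated in degree $d$ has a linear resolution if its minimal graded free resolution is of the form $0\to S(-d-p)^{\beta_p}\to\cdots\to S(-d-1)^{\beta_1}\to S(-d)^{\beta_0}\to I\to 0$. With $G(I)$ the minimal set of monomial generators, $I$ has linear quotients if $G(I)$ can be ordered $v_1,\ldots,v_m$ so that each colon ideal $\langle v_1,\ldots,v_{i-1}\rangle : v_i$, $2\le i\le m$, is generated by a subset of the variables. Variable-decomposable (for squarefree monomial ideals), recursively: $|G(I)|=1$, or there is a variable $x_l$ such that, with $I_{x_l}$ generated by the elements of $G(I)$ not divisible by $x_l$ and $I^{x_l}$ generated by those divisible by $x_l$: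 $I_{x_l}\ne 0$; for each $u\in G(I_{x_l})$ there is $v\in G(I^{x_l})$ with $v/\gcd(u,v)=x_l$; and both $I_{x_l}$ and $I^{x_l}$ are variable-decomposable.
   Formalization: The claim ''linear resolution if and only if t=n-2 or t=n-1'' is stated only for t<n, since for t=n the ideal is principal, generated by x_1...x_n, and does have a linear resolution; that fact is stated separately. *)

(* Defs.v *)
From HB Require Import structures.
From mathcomp Require Import all_boot all_order all_algebra.
From mathcomp Require Export mpoly.

Set Implicit Arguments.
Unset Strict Implicit.
Unset Printing Implicit Defensive.

Import GRing.Theory.
Local Open Scope ring_scope.

(* A directed graph on n vertices is a relation e : rel 'I_n; vertex i of
   {1, ..., n} is the ordinal i - 1.  ordS i is the successor of i modulo n. *)
Definition cycle_digraph (n : nat) : rel 'I_n := fun i j => j == ordS i.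

(* The edges of such a sequence have distinct sources, so they are distinct
   as soon as the vertices are. *)
Definition is_path (n : nat) (e : rel 'I_n) (t : nat) (p : t.-tuple 'I_n) : bool :=
  uniq p && sorted e p.

Section Ideals.
Variables (k : fieldType) (n : nat).
Notation S := {mpoly k[n]}.

(* Ideals are represented by their membership predicates. *)
Definition ideal_gen (A : S -> Prop) : S -> Prop := fun p =>
  exists (r : nat) (c g : 'I_r -> S),
    (forall i, A (g i)) /\ p = \sum_(i < r) c i * g i.

Definition ideal_eq (I J : S -> Prop) : Prop := forall p, I p <-> J p.

Definition monomial_gen (A : 'X_{1..n} -> Prop) : S -> Prop :=
  ideal_gen (fun p => exists2 m, A m & p = 'X_[m]).

Definition variable_gen (A : {set 'I_n}) : S -> Prop :=
  ideal_gen (fun p => exists2 j, j \in A & p = 'X_j).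

Definition colon (I : S -> Prop) (q : S) : S -> Prop := fun p => I (p * q).

Definition path_ideal (e : rel 'I_n) (t : nat) : S -> Prop :=
  ideal_gen (fun q => exists2 p : t.-tuple 'I_n,
                        is_path e p & q = \prod_(i <- p) 'X_i).

Definition monomial_ideal (I : S -> Prop) : Prop :=
  exists A : 'X_{1..n} -> Prop, ideal_eq I (monomial_gen A).

Definition squarefree_monomial_ideal (I : S -> Prop) : Prop :=
  exists2 A : 'X_{1..n} -> Prop, ideal_eq I (monomial_gen A)
    & forall m, A m -> forall i, (m i <= 1)%N.

(* The set G(I), each monomial being given by its exponent vector. *)
Definition min_gens (I : S -> Prop) (m : 'X_{1..n}) : Prop :=
  I 'X_[m] /\ forall m', I 'X_[m'] -> (m' <= m)%MM -> m' = m.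

(* A graded free resolution 0 <- I <- F_0 <- F_1 <- ... of finite length, with
   F_i = \bigoplus_j S(- shift i j), 0 <= j < rank i.  Elements of F_i are row
   vectors and the maps, given by right multiplication, preserve degrees. *)
Record graded_free_resolution (I : S -> Prop) := GradedFreeResolution {
  res_rank : nat -> nat;
  res_shift : forall i, 'I_(res_rank i) -> nat;
  res_aug : 'cV[S]_(res_rank 0);
  res_diff : forall i, 'M[S]_(res_rank i.+1, res_rank i);
  res_aug_graded : forall j, {in msupp (res_aug j ord0),
      forall m : 'X_{1..n}, mdeg m = res_shift j};
  res_diff_graded : forall i j l, {in msupp (res_diff i j l),
      forall m : 'X_{1..n}, (mdeg m + res_shift l)%N = res_shift j};
  res_aug_image : forall p,
      I p <-> exists v : 'rV[S]_(res_rank 0), p = (v *m res_aug) ord0 ord0;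
  res_exact0 : forall v : 'rV[S]_(res_rank 0),
      v *m res_aug = 0 <-> exists w, v = w *m res_diff 0;
  res_exact : forall i (v : 'rV[S]_(res_rank i.+1)),
      v *m res_diff i = 0 <-> exists w, v = w *m res_diff i.+1;
  res_finite : exists N, forall i, (N < i)%N -> res_rank i = 0%N
}.

(* The image of each differential lies in (x_1, ..., x_n) F_i. *)
Definition minimal_resolution (I : S -> Prop) (F : graded_free_resolution I) :=
  forall i j l, (res_diff F i j l)@_0%MM = 0.

Definition has_linear_resolution (I : S -> Prop) : Prop :=
  exists (d : nat) (F : graded_free_resolution I),
    minimal_resolution F /\
    forall i (j : 'I_(res_rank F i)), res_shift j = (d + i)%N.

Definition has_linear_quotients (I : S -> Prop) : Prop :=
  monomial_ideal I /\
  exists v : seq 'X_{1..n},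
    [/\ uniq v,
        forall m, m \in v <-> min_gens I m
      & forall i, (0 < i < size v)%N -> exists A : {set 'I_n},
          ideal_eq (colon (monomial_gen (fun m => m \in take i v))
                          'X_[nth 0%MM v i])
                   (variable_gen A)].

Definition mgcd (u v : 'X_{1..n}) : 'X_{1..n} :=
  [multinom minn (u i) (v i) | i < n].

(* I_{x_l} *)
Definition ideal_nodiv (I : S -> Prop) (l : 'I_n) : S -> Prop :=
  monomial_gen (fun m => min_gens I m /\ m l = 0%N).

(* I^{x_l} *)
Definition ideal_div (I : S -> Prop) (l : 'I_n) : S -> Prop :=
  monomial_gen (fun m => min_gens I m /\ (0 < m l)%N).

Inductive var_decomp : (S -> Prop) -> Prop :=
| VarDecompOne (I : S -> Prop) (u : 'X_{1..n}) :
    (forall m, min_gens I m <-> m = u) -> var_decomp I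
| VarDecompStep (I : S -> Prop) (l : 'I_n) :
    (exists2 p, ideal_nodiv I l p & p != 0) ->
    (forall u, min_gens (ideal_nodiv I l) u ->
       exists2 v, min_gens (ideal_div I l) v & (v - mgcd u v)%MM = U_(l)%MM) ->
    var_decomp (ideal_nodiv I l) ->
    var_decomp (ideal_div I l) ->
    var_decomp I.

Definition variable_decomposable (I : S -> Prop) : Prop :=
  squarefree_monomial_ideal I /\ var_decomp I.

End Ideals.

(* Main.v *)
Require Import Defs.
From mathcomp Require Import all_boot all_order all_algebra.
From mathcomp Require Import zify ring.

(** The directed paths with t vertices of an N-cycle are the cyclic arcs of t
    consecutive vertices, so the path ideal is generated by the monomials
    u_a = x_a x_(a+1) ... x_(a+t-1), with a in Z/N.  If t = N they all coincide
    and the ideal is principal; if t < N they are N distinct monomials of the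
    same degree, hence the minimal generators.  Below, N is written n.+2.

    The three properties are decided separately: all of them hold when
    t >= N - 2 and all of them fail when t <= N - 3.  The failures rest on one
    fact ([arc_mnm_adjacent]): for 2 <= t <= N - 2, a generator dividing x_j u_a
    is u_a itself, or u_(a+1) with j = a + t, or u_(a-1) with j = a - 1.

    Let t <= N - 3.  A shedding variable x_l is impossible, because u_(l+2) and
    both its neighbours u_(l+1), u_(l+3) avoid x_l ([not_var_decomp_arcs]).
    Linear quotients are impossible, because of the two neighbours u_(c-1) and
    u_(c+1) of the last generator u_c, the later one can only be reached from
    its other side, through a variable that does not divide the earlier one
    ([not_linear_quotients_arcs]).  For linear resolutions, the linear relations
    between the u_a are spanned by the N slides
    x_a u_(a+1) = x_(a+t) u_a.  The slides satisfy no relation with linear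
    coefficients, so in a linear resolution they would be independent; but
    going once around the cycle, with the complements of the arcs of length
    t + 1 as coefficients, gives a relation between them
    ([not_linear_resolution_arcs]).  The step from the absence of linear
    second syzygies to the absence of second syzygies is
    [linear_resolution_no_second_syzygies]: a linear resolution agrees in its
    first two steps, up to changes of basis over k, with any presentation that
    is minimal and linear.

    Let t >= N - 2.  The generators u_a, ..., u_(a+r-1) with r <= t + 1 are
    variable-decomposable, since x_(a+t) divides all of them except u_a; for
    t = N - 2 one more variable splits the whole cycle into two such intervals
    ([var_decomp_arcs]).  The order u_0, u_1, ... has linear quotients
    ([linear_quotients_arcs]).  The linear resolutions are explicit, of length
    0, 1 and 2 for t = N, N - 1 and N - 2.  For t = N - 1 the generators are
    the X / x_a with X the product of all variables, and a relation
    sum v_a X / x_a = 0 forces v_a = c_a x_a with sum c_a = 0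
    ([syzygy_but1]).  For t = N - 2 the generators are the
    X / (x_(a-1) x_(a-2)); subtracting slides reduces a relation between them
    to the preceding case, and the sum-zero family that remains is a cyclic
    difference ([linear_resolution_arcs_n]). *)

Set Implicit Arguments.
Unset Strict Implicit.
Unset Printing Implicit Defensive.

Import GRing.Theory.

(** * Monomial ideals, linear quotients and variable decompositions *)

Section MonomialIdeals.
Local Open Scope ring_scope.
Variables (k : fieldType) (n : nat).
Notation S := {mpoly k[n]}.
Implicit Types (I J : S -> Prop) (A B : 'X_{1..n} -> Prop) (p q : S).
Implicit Types (m u v w : 'X_{1..n}).

Lemma ideal_gen0 (G : S -> Prop) : ideal_gen G 0.
Proof.
exists 0%N, (fun=> 0), (fun=> 0); split=> [[]//|].
by rewrite big_ord0.
Qed.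

Lemma ideal_genD (G : S -> Prop) p q :
  ideal_gen G p -> ideal_gen G q -> ideal_gen G (p + q).
Proof.
move=> [r1 [c1 [g1 [G1 ->]]]] [r2 [c2 [g2 [G2 ->]]]].
pose join (f1 : 'I_r1 -> S) (f2 : 'I_r2 -> S) i :=
  match split i with inl a => f1 a | inr b => f2 b end.
exists (r1 + r2)%N, (join c1 c2), (join g1 g2); split=> [i|].
  by rewrite /join; case: (split i).
rewrite big_split_ord; congr (_ + _); apply: eq_bigr => i _; rewrite /join.
  by have /= -> := @unsplitK r1 r2 (inl i).
by have /= -> := @unsplitK r1 r2 (inr i).
Qed.

Lemma ideal_gen_sum (G : S -> Prop) (T : eqType) (r : seq T) (F : T -> S) :
  {in r, forall x, ideal_gen G (F x)} -> ideal_gen G (\sum_(x <- r) F x).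
Proof.
move=> GF; rewrite big_seq; apply: big_ind => //; first exact: ideal_gen0.
exact: ideal_genD.
Qed.

Lemma ideal_genM (G : S -> Prop) c g : G g -> ideal_gen G (c * g).
Proof.
by move=> Gg; exists 1%N, (fun=> c), (fun=> g); split=> //; rewrite big_ord1.
Qed.

Lemma ideal_gen_ext (G H : S -> Prop) :
  (forall p, G p <-> H p) -> ideal_eq (ideal_gen G) (ideal_gen H).
Proof.
by move=> GH p; split=> -[r [c [g [Gg ->]]]]; exists r, c, g; split=> // i;
   apply/GH.
Qed.

(** Multiplying by a monomial shifts supports, so membership in a monomial
    ideal is read off the support; the arguments about colons reduce to
    exponent vectors through this lemma. *)
Lemma mem_monomial_gen A p :
  monomial_gen A p <->
  {in msupp p, forall m, exists2 u, A u & (u <= m)%MM}.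
Proof.
split=> [[r [c [g [Ag ->]]]] m|suppA].
  move=> /msupp_sum_le /flatten_mapP[i _].
  have [u Au ->] := Ag i; rewrite (perm_mem (msuppMX _ _)).
  case/mapP=> m' _ ->; exists u => //; exact: lem_addr.
rewrite [p]mpolyE; apply: ideal_gen_sum => m /suppA [u Au le_um].
rewrite -(submK le_um) mpolyXD scalerAl.
by apply: ideal_genM; exists u.
Qed.

Lemma mem_monomial_genX A m :
  monomial_gen A ('X_[m] : S) <-> exists2 u, A u & (u <= m)%MM.
Proof.
rewrite mem_monomial_gen; split=> [|[u Au um] m']; first by apply; rewrite msuppX inE.
by rewrite msuppX inE => /eqP ->; exists u.
Qed.

Lemma mem_variable_gen (V : {set 'I_n}) p :
  variable_gen V p <->
  {in msupp p, forall m : 'X_{1..n}, exists2 j, j \in V & (0 < m j)%N}.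
Proof.
have -> : variable_gen V p <->
    monomial_gen (fun m => exists2 j, j \in V & m = U_(j)%MM) p.
  apply: ideal_gen_ext => q; split=> [[j jV ->]|[_ [j jV ->] ->]]; last by exists j.
  by exists U_(j)%MM => //; exists j.
have le1 j m : (U_(j) <= m)%MM = (0 < m j)%N by rewrite lep1mP lt0n.
rewrite mem_monomial_gen; split=> H m /H.
  by move=> [_ [j jV ->]]; rewrite le1; exists j.
by move=> [j jV]; rewrite -le1; exists U_(j)%MM => //; exists j.
Qed.

(** Repeated generators can be grouped, so one coefficient per index of
    the family is enough. *)
Lemma ideal_gen_family (J : finType) (P : {pred J}) (h : J -> S) p :
  ideal_gen (fun q => exists2 j, j \in P & q = h j) p ->
  exists c : J -> S, p = \sum_(j in P) c j * h j.
Proof.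
case=> r [c [g [Pg ->]]].
have [f] : exists f : 'I_r -> J, forall i, f i \in P /\ g i = h (f i).
  apply: (fin_all_exists (P := fun i j => j \in P /\ g i = h j)) => i.
  by have [j] := Pg i; exists j.
move=> fP; exists (fun j => \sum_(i | f i == j) c i).
rewrite (partition_big f (mem P)) => [|i _]; last by case: (fP i).
apply: eq_bigr => j _; rewrite big_distrl; apply: eq_bigr => i /eqP <-.
by case: (fP i) => _ ->.
Qed.

Lemma variable_gen_sum (V : {set 'I_n}) p :
  {in msupp p, forall m : 'X_{1..n}, exists2 j, j \in V & (0 < m j)%N} ->
  exists c : 'I_n -> S, p = \sum_(j in V) c j * 'X_j.
Proof. by move/mem_variable_gen; apply: ideal_gen_family. Qed.

Lemma min_gens_ext I J : ideal_eq I J -> forall m, min_gens I m <-> min_gens J m.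
Proof.
move=> IJ m; split=> -[/IJ Im minm]; split=> // m' /IJ; exact: minm.
Qed.

Lemma monomial_gen_ext A B :
  (forall m, A m <-> B m) -> ideal_eq (monomial_gen A : S -> Prop) (monomial_gen B).
Proof.
move=> AB; apply: ideal_gen_ext => p.
by split=> -[m /AB Am ->]; exists m.
Qed.

(** Every ideal met in a variable decomposition is given by an antichain of
    monomials, so this computes G(I) at each stage. *)
Lemma min_gens_antichain A :
  (forall u v, A u -> A v -> (u <= v)%MM -> u = v) ->
  forall m, min_gens (monomial_gen A : S -> Prop) m <-> A m.
Proof.
move=> antiA m; split=> [[/mem_monomial_genX [u Au um] minm]|Am].
  suff -> : m = u by [].
  by symmetry; apply: minm => //; apply/mem_monomial_genX; exists u => //; apply: lepm_refl.
split; first by apply/mem_monomial_genX; exists m => //; apply: lepm_refl.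
move=> m' /mem_monomial_genX [u Au um'] m'm.
have um : u = m by apply: antiA => //; apply: lepm_trans m'm.
by apply/mnmP=> i; apply/eqP; rewrite eqn_leq (mnm_lepP m'm) -um (mnm_lepP um').
Qed.

(** [var_decomp] looks at an ideal only through its members, which allows each
    stage of a decomposition to be replaced by a convenient description. *)
Lemma var_decomp_ext I J : ideal_eq I J -> var_decomp I -> var_decomp J.
Proof.
move=> + vdI; elim: vdI J => {I} [I u minI|I l nz xI _ IH1 _ IH2] J IJ.
  by apply: (VarDecompOne (u := u)) => m; rewrite -(min_gens_ext IJ).
have eqn : ideal_eq (ideal_nodiv I l) (ideal_nodiv J l).
  by apply: monomial_gen_ext => m; rewrite (min_gens_ext IJ).
have eqd : ideal_eq (ideal_div I l) (ideal_div J l).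
  by apply: monomial_gen_ext => m; rewrite (min_gens_ext IJ).
apply: (VarDecompStep (l := l)); [| |exact: IH1|exact: IH2].
  by have [p /eqn Jp p0] := nz; exists p.
move=> u /(min_gens_ext eqn) /xI [v Iv uv]; exists v => //.
exact/(min_gens_ext eqd).
Qed.

Lemma has_linear_resolution_ext I J :
  ideal_eq I J -> has_linear_resolution I -> has_linear_resolution J.
Proof.
move=> IJ [d [[rk sh a D a_graded D_graded Ia ex0 ex fin] [min lin]]].
have Ja p : J p <-> exists v : 'rV_(rk 0%N), p = (v *m a) ord0 ord0.
  by rewrite -Ia; split=> /IJ.
by exists d, (GradedFreeResolution a_graded D_graded Ja ex0 ex fin).
Qed.

Lemma has_linear_quotients_ext I J :
  ideal_eq I J -> has_linear_quotients I -> has_linear_quotients J.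
Proof.
move=> IJ [[A IA] [v [uniq_v v_gens lq]]]; split.
  by exists A => p; rewrite -(IA p); split=> /IJ.
by exists v; split=> // m; rewrite v_gens (min_gens_ext IJ).
Qed.

Lemma lepmDU_coord (u v : 'X_{1..n}) l :
  (u <= v + U_(l))%MM -> forall i, (u i <= v i + (l == i))%N.
Proof. by move=> /mnm_lepP uv i; have := uv i; rewrite mnmDE mnm1E. Qed.

(** The exchange condition v / gcd (u, v) = x_l amounts to two divisibility
    conditions: v divides x_l u, and x_l occurs more often in v than in u. *)
Lemma sub_gcd_eqU u v l :
  (v - mgcd u v)%MM = U_(l)%MM <-> (v <= u + U_(l))%MM /\ (u l < v l)%N.
Proof.
split=> [/mnmP E|[/lepmDU_coord vu ul]].
  have E' i : (v i - minn (u i) (v i))%N = (l == i) by rewrite -mnm1E -E mnmBE mnmE.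
  split; last by have := E' l; rewrite eqxx; lia.
  by apply/mnm_lepP => i; rewrite mnmDE mnm1E -E'; lia.
apply/mnmP=> i; rewrite mnmBE mnm1E mnmE; have := vu i.
case: eqP => [<-|_]; lia.
Qed.

(** The usual criterion for a step of linear quotients.  If the colon is
    generated by variables, one of them divides b / gcd (b, w), and it belongs
    to the colon because some generator c divides its product with w; conversely
    the variables with such a c generate the colon. *)
Lemma colon_variablesP (s : seq 'X_{1..n}) w :
  (exists V : {set 'I_n},
     ideal_eq (colon (monomial_gen (fun m => m \in s)) 'X_[w] : S -> Prop)
              (variable_gen V))
  <-> {in s, forall b : 'X_{1..n}, exists2 l, (w l < b l)%N
             & exists2 c, c \in s & (c <= w + U_(l))%MM}.
Proof.
have colonP p : colon (monomial_gen (fun m => m \in s)) 'X_[w] p <->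
    {in msupp p, forall m, exists2 b, b \in s & (b <= m + w)%MM}.
  rewrite /colon mem_monomial_gen; split=> H m.
    by move=> pm; apply: H; rewrite (perm_mem (msuppMX _ _)) addmC map_f.
  by rewrite (perm_mem (msuppMX _ _)) => /mapP[m' /H + ->]; rewrite addmC.
split=> [[V VP] b bs|H].
  have : colon (monomial_gen (fun m => m \in s)) 'X_[w] ('X_[(b - w)] : S).
    apply/colonP => m; rewrite msuppX inE => /eqP ->; exists b => //.
    by apply/mnm_lepP=> i; rewrite mnmDE mnmBE; lia.
  move=> /VP/mem_variable_gen/(_ (b - w)%MM); rewrite msuppX mem_head.
  move=> /(_ isT) [l lV]; rewrite mnmBE subn_gt0 => wb; exists l => //.
  have : variable_gen V ('X_l : S).
    apply/mem_variable_gen => m; rewrite msuppX inE => /eqP ->.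
    by exists l; rewrite // mnm1E eqxx.
  move=> /VP/colonP/(_ U_(l)%MM); rewrite msuppX mem_head.
  by move=> /(_ isT) [c cs]; rewrite addmC; exists c.
exists [set l | has (fun c : 'X_{1..n} => (c <= w + U_(l))%MM) s] => p.
rewrite colonP mem_variable_gen; split=> pP m /pP.
  move=> [b bs bmw]; have [l wb [c cs cwl]] := H b bs; exists l.
    by rewrite inE; apply/hasP; exists c.
  by move/mnm_lepP: bmw => /(_ l); rewrite mnmDE; lia.
move=> [l]; rewrite inE => /hasP[c cs /lepmDU_coord cwl] ml; exists c => //.
by apply/mnm_lepP => i; rewrite mnmDE; have := cwl i; case: eqP => [<-|_]; lia.
Qed.

End MonomialIdeals.

(** * Homogeneous matrices and linear resolutions *)

Section HomogeneousMatrices.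
Local Open Scope ring_scope.
Variables (k : fieldType) (n : nat).
Notation S := {mpoly k[n]}.

Definition mx_homog d p q (M : 'M[S]_(p, q)) := forall i j, M i j \is d.-homog.

Definition mx_part d p q (M : 'M[S]_(p, q)) : 'M[S]_(p, q) :=
  map_mx (pihomog mdeg d) M.

Lemma mx_part_homog d p q (M : 'M[S]_(p, q)) : mx_homog d (mx_part d M).
Proof. by move=> i j; rewrite mxE; apply: pihomogP. Qed.

Lemma mx_part_id d p q (M : 'M[S]_(p, q)) : mx_homog d M -> mx_part d M = M.
Proof. by move=> hM; apply/matrixP=> i j; rewrite mxE pihomog_dE. Qed.

Lemma mx_homogM d e p q r (M : 'M[S]_(p, q)) (N : 'M[S]_(q, r)) :
  mx_homog d M -> mx_homog e N -> mx_homog (d + e) (M *m N).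
Proof.
by move=> hM hN i j; rewrite mxE; apply: rpred_sum => l _; apply: dhomogM.
Qed.

Lemma mx_homogB d p q (M N : 'M[S]_(p, q)) :
  mx_homog d M -> mx_homog d N -> mx_homog d (M - N).
Proof. by move=> hM hN i j; rewrite !mxE; apply: rpredB. Qed.

Lemma mx_homog1 p : mx_homog 0 (1%:M : 'M[S]_p).
Proof.
move=> i j; rewrite mxE; case: (i == j); first exact: dhomog1.
exact: dhomog0.
Qed.

Lemma mx_homog_row d p q (M : 'M[S]_(p, q)) i : mx_homog d M -> mx_homog d (row i M).
Proof. by move=> hM i' j; rewrite mxE. Qed.

(** Taking homogeneous parts is linear over the homogeneous elements, up to
    the shift of degrees.  This lets every factorization below be replaced by a
    factorization with entries of the expected degree. *)
Lemma pihomogM d e (f g : S) :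
  g \is e.-homog -> pihomog mdeg (d + e) (f * g) = pihomog mdeg d f * g.
Proof.
move=> hg; rewrite {1}[f]mpolyE mulr_suml raddf_sum pihomogE mulr_suml /=.
rewrite [RHS]big_mkcond; apply: eq_bigr => m _.
have hm : (f@_m *: 'X_[m]) * g \is (mdeg m + e).-homog.
  by apply: dhomogM => //; apply: rpredZ; rewrite dhomogX.
case: eqP => [<-|/eqP ne]; first exact: pihomog_dE.
by apply: (pihomog_ne0 _ hm); rewrite eqn_add2r.
Qed.

Lemma mx_partM d e p q r (M : 'M[S]_(p, q)) (N : 'M[S]_(q, r)) :
  mx_homog e N -> mx_part (d + e) (M *m N) = mx_part d M *m N.
Proof.
move=> hN; apply/matrixP=> i j; rewrite !mxE raddf_sum; apply: eq_bigr => l _.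
by rewrite /= mxE pihomogM.
Qed.

Lemma mx_part_lt d e p q r (M : 'M[S]_(p, q)) (N : 'M[S]_(q, r)) :
  mx_homog e N -> (d < e)%N -> mx_part d (M *m N) = 0.
Proof.
move=> hN de; apply/matrixP=> i j; rewrite !mxE raddf_sum big1 // => l _ /=.
rewrite [M i l]mpolyE mulr_suml raddf_sum big1 // => m _ /=.
have hm : ((M i l)@_m *: 'X_[m]) * N l j \is (mdeg m + e).-homog.
  by apply: dhomogM => //; apply: rpredZ; rewrite dhomogX.
by apply: (pihomog_ne0 _ hm); lia.
Qed.

Lemma factor_rows p q r (M : 'M[S]_(p, r)) (D : 'M[S]_(q, r)) :
  (forall i, exists w, row i M = w *m D) -> exists W, M = W *m D.
Proof.
move=> /(fin_all_exists (P := fun i w => row i M = w *m D)) [w wP].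
exists (\matrix_i w i); apply/row_matrixP => i.
by rewrite row_mul rowK wP.
Qed.

Lemma factor_rows_homog d e p q r (M : 'M[S]_(p, r)) (D : 'M[S]_(q, r)) :
  mx_homog e D -> mx_homog (d + e) M ->
  (forall i, exists w, row i M = w *m D) ->
  exists2 W, mx_homog d W & M = W *m D.
Proof.
move=> hD hM /factor_rows[W MW]; exists (mx_part d W); first exact: mx_part_homog.
by rewrite -(mx_partM _ _ hD) -MW mx_part_id.
Qed.

(** Comparison with an arbitrary linear resolution with augmentation a and
    differentials D0, D1.  Degrees force the transition matrices between a and
    u, and between D0 and Sg, to have entries in k: a = C u, u = V a with
    C, V mutually inverse, and D0 C = B Sg, Sg V = W D0 with B, W mutually
    inverse.  Then D1 B consists of linear relations between the rows of Sg, so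
    D1 = 0 and D0, hence Sg, is injective on row vectors. *)
Lemma linear_resolution_no_second_syzygies (I : S -> Prop) t r s
    (u : 'cV[S]_r) (Sg : 'M[S]_(s, r)) :
  (0 < n)%N -> (0 < r)%N -> mx_homog t u -> mx_homog 1 Sg ->
  (forall p, I p <-> exists v : 'rV[S]_r, p = (v *m u) ord0 ord0) ->
  (forall c : 'rV[S]_r, mx_homog 0 c -> c *m u = 0 -> c = 0) ->
  Sg *m u = 0 ->
  (forall l : 'rV[S]_r, mx_homog 1 l -> l *m u = 0 -> exists c, l = c *m Sg) ->
  (forall l : 'rV[S]_s, mx_homog 1 l -> l *m Sg = 0 -> l = 0) ->
  has_linear_resolution I ->
  forall v : 'rV[S]_s, v *m Sg = 0 -> v = 0.
Proof.
move=> n0 r0 hu hSg Iu indep Sgu linsyz nolin [d [F [_ lin]]].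
set a := res_aug F; set D0 := res_diff F 0; set D1 := res_diff F 1.
have ha : mx_homog d a.
  move=> j o; rewrite ord1; apply/dhomogP => m mj /=.
  by have := res_aug_graded mj; rewrite lin addn0.
have hD i : mx_homog 1 (res_diff F i).
  move=> j l; apply/dhomogP => m mj /=.
  by have := res_diff_graded mj; rewrite !lin; lia.
have rv1 p (v : 'rV[S]_p) (b : 'cV[S]_p) f : f = (v *m b) ord0 ord0 -> v *m b = f%:M.
  by move=> ->; apply/matrixP=> i j; rewrite !ord1 [RHS]mxE eqxx mulr1n.
have row_cV p (b : 'cV[S]_p) i : row i b = (b i ord0)%:M.
  by apply/matrixP=> i' j; rewrite !ord1 !mxE eqxx mulr1n.
have a_u i : exists w, row i a = w *m u.
  have [w aw] : exists w : 'rV[S]_r, a i ord0 = (w *m u) ord0 ord0.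
    apply/Iu/(res_aug_image F); exists (delta_mx ord0 i).
    by rewrite -rowE mxE.
  by exists w; rewrite row_cV (rv1 _ _ _ _ aw).
have u_a i : exists w, row i u = w *m a.
  have [w aw] : exists w : 'rV[S]_(res_rank F 0), u i ord0 = (w *m a) ord0 ord0.
    apply/(res_aug_image F)/Iu; exists (delta_mx ord0 i).
    by rewrite -rowE mxE.
  by exists w; rewrite row_cV (rv1 _ _ _ _ aw).
have u_neq0 : u != 0.
  apply/eqP=> u0; have /matrixP/(_ ord0 (Ordinal r0)) :
      delta_mx ord0 (Ordinal r0) = 0 :> 'rV[S]_r.
    apply: indep; last by rewrite u0 mulmx0.
    move=> i j; rewrite mxE; case: (_ && _); first exact: dhomog1.
    exact: dhomog0.
  by rewrite !mxE !eqxx => /eqP; rewrite oner_eq0.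
have dt : d = t.
  have [W1 aE] := factor_rows a_u; have [W2 uE] := factor_rows u_a.
  case: (ltngtP d t) => // ltdt; case/eqP: u_neq0.
    by rewrite uE -(mx_part_id ha) aE (mx_part_lt _ hu ltdt) mulmx0.
  by rewrite -(mx_part_id hu) uE (mx_part_lt _ ha ltdt).
rewrite {}dt in ha lin.
have [C hC aE] := @factor_rows_homog 0 t _ _ _ a u hu ha a_u.
have [V hV uE] := @factor_rows_homog 0 t _ _ _ u a ha hu u_a.
have zero_rows p q (M : 'M[S]_(p, q)) : (forall i, row i M = 0) -> M = 0.
  by move=> M0; apply/row_matrixP => i; rewrite M0 row0.
(* The u_i are linearly independent over k. *)
have VC : V *m C = 1%:M.
  apply/eqP; rewrite -subr_eq0; apply/eqP/zero_rows => i; apply: indep.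
    apply/mx_homog_row/mx_homogB; last exact: mx_homog1.
    exact: (mx_homogM hV hC).
  by rewrite -row_mul mulmxBl mul1mx -mulmxA -aE -uE subrr row0.
have lin0 p q (w : 'rV[S]_p) (D : 'M[S]_(p, q)) :
    mx_homog 1 D -> mx_homog 0 (w *m D) -> w *m D = 0.
  by move=> hDl h0; rewrite -(mx_part_id h0) (mx_part_lt _ hDl).
(* C V - 1 has constant entries and consists of relations of a, which are
   combinations of the linear rows of D0; by degree it vanishes. *)
have CV : C *m V = 1%:M.
  apply/eqP; rewrite -subr_eq0; apply/eqP/zero_rows => i.
  have h0 : mx_homog 0 (row i (C *m V - 1%:M)).
    apply/mx_homog_row/mx_homogB; last exact: mx_homog1.
    exact: (mx_homogM hC hV).
  have [|w wE] := (@res_exact0 _ _ _ F (row i (C *m V - 1%:M))).1.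
    by rewrite -row_mul mulmxBl mul1mx -mulmxA -uE -aE subrr row0.
  by rewrite wE; apply: lin0 => //; rewrite -wE.
have D0a : D0 *m a = 0.
  apply: zero_rows => i; rewrite row_mul; apply/(@res_exact0 _ _ _ F).
  by exists (delta_mx ord0 i); rewrite -rowE.
have D1D0 : D1 *m D0 = 0.
  apply: zero_rows => i; rewrite row_mul; apply/(@res_exact _ _ _ F 0).
  by exists (delta_mx ord0 i); rewrite -rowE.
have [B hB D0C] : exists2 B, mx_homog 0 B & D0 *m C = B *m Sg.
  have hDC : mx_homog (0 + 1) (D0 *m C) by apply: (mx_homogM (hD 0) hC).
  apply: factor_rows_homog => // i; apply: linsyz; first exact: mx_homog_row.
  by rewrite -row_mul -mulmxA -aE D0a row0.
have [W hW SgV] : exists2 W, mx_homog 0 W & Sg *m V = W *m D0.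
  have hSV : mx_homog (0 + 1) (Sg *m V) by apply: (mx_homogM hSg hV).
  apply: factor_rows_homog (hD 0) hSV _ => i.
  by apply/(@res_exact0 _ _ _ F); rewrite -row_mul -mulmxA -uE Sgu row0.
(* The same degree argument, one step further in the resolution. *)
have BW : B *m W = 1%:M.
  apply/eqP; rewrite -subr_eq0; apply/eqP/zero_rows => i.
  have h0 : mx_homog 0 (row i (B *m W - 1%:M)).
    apply/mx_homog_row/mx_homogB; last exact: mx_homog1.
    exact: (mx_homogM hB hW).
  have [|w wE] := (@res_exact _ _ _ F 0 (row i (B *m W - 1%:M))).1.
    rewrite -row_mul mulmxBl mul1mx -mulmxA -SgV mulmxA -D0C -mulmxA CV.
    by rewrite mulmx1 subrr row0.
  by rewrite wE; apply: lin0 => //; rewrite -wE.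
have D10 : D1 = 0.
  rewrite -[D1]mulmx1 -BW mulmxA; suff -> : D1 *m B = 0 by rewrite mul0mx.
  apply: zero_rows => i; apply: nolin.
    exact/mx_homog_row/(mx_homogM (hD 1%N) hB).
  by rewrite -row_mul -mulmxA -D0C mulmxA D1D0 mul0mx row0.
(* Constant relations of Sg are not covered by the hypothesis on linear ones,
   so they are multiplied by a variable. *)
have WB : W *m B = 1%:M.
  apply/eqP; rewrite -subr_eq0; apply/eqP/zero_rows => i.
  pose x : S := 'X_(Ordinal n0).
  have x0 : x != 0 by rewrite -msupp_eq0 msuppX.
  suff /matrixP H : x *: row i (W *m B - 1%:M) = 0.
    apply/matrixP=> i' j; have := H i' j; rewrite !mxE => /eqP.
    by rewrite mulf_eq0 (negPf x0) /= => /eqP.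
  apply: nolin.
    move=> i' j; rewrite mxE; apply: (@dhomogM _ _ _ 1 _ 0).
      by rewrite dhomogX /= mdeg1.
    apply/mx_homog_row/mx_homogB; last exact: mx_homog1.
    exact: (mx_homogM hW hB).
  rewrite -scalemxAl -row_mul mulmxBl mul1mx -mulmxA -D0C mulmxA -SgV.
  by rewrite -mulmxA VC mulmx1 subrr row0 scaler0.
move=> v vSg.
have [|y yE] := (@res_exact _ _ _ F 0 (v *m W)).1.
  by rewrite -mulmxA -SgV mulmxA vSg mul0mx.
by rewrite -[v]mulmx1 -WB mulmxA yE -/D1 D10 mulmx0 mul0mx.
Qed.

Definition length2_rank r0 r1 r2 (i : nat) : nat :=
  match i with 0 => r0 | 1 => r1 | 2 => r2 | _ => 0 end.

Definition length2_diff r0 r1 r2 (D0 : 'M[S]_(r1, r0)) (D1 : 'M[S]_(r2, r1)) i :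
    'M[S]_(length2_rank r0 r1 r2 i.+1, length2_rank r0 r1 r2 i) :=
  match i with 0 => D0 | 1 => D1 | _ => 0 end.

Lemma has_linear_resolution_length2 (I : S -> Prop) d r0 r1 r2
    (a : 'cV[S]_r0) (D0 : 'M[S]_(r1, r0)) (D1 : 'M[S]_(r2, r1)) :
  mx_homog d a -> mx_homog 1 D0 -> mx_homog 1 D1 ->
  (forall p, I p <-> exists v : 'rV[S]_r0, p = (v *m a) ord0 ord0) ->
  D0 *m a = 0 -> D1 *m D0 = 0 ->
  (forall v : 'rV[S]_r0, v *m a = 0 -> exists w, v = w *m D0) ->
  (forall v : 'rV[S]_r1, v *m D0 = 0 -> exists w, v = w *m D1) ->
  (forall v : 'rV[S]_r2, v *m D1 = 0 -> v = 0) ->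
  has_linear_resolution I.
Proof.
move=> ha hD0 hD1 Ia D0a D1D0 ex0 ex1 ex2.
pose D := length2_diff D0 D1.
have hD i : mx_homog 1 (D i).
  case: i => [|[|i]] //= j l; rewrite mxE; exact: dhomog0.
pose shift i (j : 'I_(length2_rank r0 r1 r2 i)) := (d + i)%N.
have aug_graded (j : 'I_r0) : {in msupp (a j ord0),
    forall m : 'X_{1..n}, mdeg m = @shift 0%N j}.
  by move=> m; rewrite /shift addn0; apply/dhomogP: m.
have diff_graded i j l : {in msupp (D i j l),
    forall m : 'X_{1..n}, (mdeg m + @shift i l)%N = @shift i.+1 j}.
  by move=> m /(dhomog_mf (hD i j l)) ->; rewrite /shift addnS add1n.
have exact0 (v : 'rV[S]_r0) : v *m a = 0 <-> exists w, v = w *m D 0%N.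
  split=> [/ex0 //|[w ->]]; by rewrite -mulmxA D0a mulmx0.
have exactD i (v : 'rV[S]_(length2_rank r0 r1 r2 i.+1)) :
    v *m D i = 0 <-> exists w, v = w *m D i.+1.
  case: i v => [|[|i]] /= v.
  - split=> [/ex1 //|[w ->]]; by rewrite -mulmxA D1D0 mulmx0.
  - split=> [/ex2 ->|[w ->]]; first by exists 0; rewrite mul0mx.
    by rewrite /D /= mulmx0 mul0mx.
  - by split=> _; [exists 0|]; rewrite (thinmx0 v) mul0mx.
have fin : exists N, forall i, (N < i)%N -> length2_rank r0 r1 r2 i = 0%N.
  by exists 2%N => -[|[|[|i]]].
exists d, (GradedFreeResolution aug_graded diff_graded Ia exact0 exactD fin).
split=> // i j l; apply: dhomog_nemf_coeff (hD i j l) _.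
by rewrite /= mdeg0.
Qed.

End HomogeneousMatrices.

(** * Relations between monomials *)

Section MonomialRelations.
Local Open Scope ring_scope.
Variables (k : fieldType) (n : nat).
Notation S := {mpoly k[n]}.
Implicit Types (p q : S) (m : 'X_{1..n}).

Definition monomial_col r (f : 'I_r -> 'X_{1..n}) : 'cV[S]_r := \col_i 'X_[f i].

Lemma monomial_colE r (f : 'I_r -> 'X_{1..n}) (v : 'rV[S]_r) :
  v *m monomial_col f = (\sum_i v ord0 i * 'X_[f i])%:M.
Proof.
apply/matrixP => i j; rewrite !ord1 !mxE eqxx mulr1n.
by apply: eq_bigr => l _; rewrite mxE.
Qed.

Lemma monomial_col_eq0 r (f : 'I_r -> 'X_{1..n}) (v : 'rV[S]_r) :
  v *m monomial_col f = 0 <-> \sum_i v ord0 i * 'X_[f i] = 0.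
Proof.
rewrite monomial_colE; split=> [/matrixP/(_ ord0 ord0)|->]; last by rewrite raddf0.
by rewrite !mxE eqxx mulr1n.
Qed.

Lemma monomial_col_homog r (f : 'I_r -> 'X_{1..n}) d :
  (forall i, mdeg (f i) = d) -> mx_homog d (monomial_col f).
Proof. by move=> fd i j; rewrite mxE dhomogX /= fd. Qed.

(** This is the form in which the augmentation of a resolution describes an
    ideal. *)
Lemma monomial_gen_col r (f : 'I_r -> 'X_{1..n}) p :
  monomial_gen (fun m => exists i, m = f i) p <->
  exists v : 'rV[S]_r, p = (v *m monomial_col f) ord0 ord0.
Proof.
split=> [Ip|[v ->]]; last first.
  rewrite mxE; apply: ideal_gen_sum => i _; apply: ideal_genM.
  by exists (f i); [exists i | rewrite mxE].
have /ideal_gen_family[c ->] :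
    ideal_gen (fun q : S => exists2 i : 'I_r, i \in predT & q = 'X_[f i]) p.
  apply: (iffLR (ideal_gen_ext _ _)) Ip => q.
  by split=> [[_ [i ->] ->]|[i _ ->]]; [exists i | exists (f i) => //; exists i].
by exists (\row_i c i); rewrite mxE; apply: eq_bigr => i _; rewrite !mxE.
Qed.

Lemma mcoeffMXE p m M :
  (p * 'X_[m])@_M = if (m <= M)%MM then p@_(M - m) else 0.
Proof.
case: ifP => [le|nle]; first by rewrite -{1}(submK le) addmC mcoeffMX.
apply: memN_msupp_eq0; rewrite (perm_mem (msuppMX _ _)).
by apply: contraFN nle => /mapP[m' _ ->]; apply: lem_addr.
Qed.

(** Each monomial of v_i f_i has to cancel against a monomial of some other
    v_j f_j. *)
Lemma syzygy_support r (f : 'I_r -> 'X_{1..n}) (v : 'I_r -> S) :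
  \sum_i v i * 'X_[f i] = 0 ->
  forall i, {in msupp (v i), forall m, exists2 j, j != i & (f j <= m + f i)%MM}.
Proof.
move=> + i m mi; rewrite (bigD1 i) //= => /(congr1 (mcoeff (m + f i)%MM)).
rewrite mcoeffD mcoeff0 [(m + f i)%MM]addmC mcoeffMX raddf_sum /=.
move: mi; rewrite mcoeff_msupp => /[swap] /(canRL (addrK _)).
have [/existsP[j /andP[ji le]] _ _|/existsPn none ->] :=
    boolP [exists j, (j != i) && (f j <= f i + m)%MM].
  by exists j => //; rewrite addmC.
rewrite big1 ?subrr ?eqxx // => j ji; rewrite mcoeffMXE.
by have := none j; rewrite ji /= => /negPf ->.
Qed.

(** The variable 'X_j is prime and differs from 'X_i. *)
Lemma dvdX_mulX p q i j : i != j -> p * 'X_i = q * 'X_j ->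
  {in msupp p, forall m, (0 < m j)%N}.
Proof.
move=> ij pq m mp.
have : (U_(i) + m)%MM \in msupp (q * 'X_j).
  by rewrite -pq (perm_mem (msuppMX _ _)) map_f.
rewrite (perm_mem (msuppMX _ _)) => /mapP[m' _ /mnmP/(_ j)].
by rewrite !mnmDE !mnm1E eqxx (negPf ij) add0n => ->.
Qed.

Lemma dvdX_factor p i : {in msupp p, forall m : 'X_{1..n}, (0 < m i)%N} ->
  exists c, p = c * 'X_i.
Proof.
move=> H; have [m /H mi|c ->] := @variable_gen_sum k n [set i] p.
  by exists i; rewrite ?inE.
by rewrite big_set1; exists (c i).
Qed.

Lemma dvdX2_factor p i j : i != j ->
  {in msupp p, forall m : 'X_{1..n}, (0 < m i)%N || (0 < m j)%N} ->
  exists c d, p = c * 'X_i + d * 'X_j.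
Proof.
move=> ij H; have [m /H mij|c ->] := @variable_gen_sum k n [set i; j] p.
  by case/orP: mij; [exists i|exists j]; rewrite // !inE eqxx ?orbT.
by rewrite big_setU1 ?inE //= big_set1; exists (c i), (c j).
Qed.

Lemma mpolyX_neq0 m : 'X_[m] != 0 :> S.
Proof. by rewrite -msupp_eq0 msuppX. Qed.

Lemma linear_form_eq p q : p \is 1.-homog -> q \is 1.-homog ->
  (forall i, p@_U_(i) = q@_U_(i)) -> p = q.
Proof.
move=> hp hq pq; apply/mpolyP => m.
have [/eqP/mdeg1P[i /eqP ->]//|m1] := eqVneq (mdeg m) 1%N.
by rewrite (dhomog_nemf_coeff hp) ?(dhomog_nemf_coeff hq).
Qed.

End MonomialRelations.

(** * Arcs of the cycle *)

Section Arcs.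
Local Open Scope ring_scope.
Variables (n : nat).
Local Notation V := 'I_n.+2.
Implicit Types (a b i j : V).

(** The exponents of x_a x_(a+1) ... x_(a+t-1).  Subtraction in Z/(n+2)
    measures how far b lies after a, so the definition is invariant under rotation. *)
Definition arc_mnm t (a : V) : 'X_{1..n.+2} :=
  [multinom (nat_of_ord (b - a)%R < t)%N : nat | b < n.+2].

Lemma val_natrZ e : (e < n.+2)%N -> (e%:R : V) = e :> nat.
Proof. by move=> lt_e; rewrite Zp_nat /= modn_small. Qed.

Lemma natrZ_inj e1 e2 : (e1 < n.+2)%N -> (e2 < n.+2)%N ->
  e1%:R = e2%:R :> V -> e1 = e2.
Proof. by move=> lt1 lt2 eq12; rewrite -(val_natrZ lt1) eq12 val_natrZ. Qed.

Lemma natrZ_char : n.+2%:R = 0 :> V.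
Proof. by apply/val_inj; rewrite Zp_nat /= modnn. Qed.

(** Writing vertices as a fixed vertex plus a number smaller than n+2 turns
    statements about arcs into linear arithmetic. *)
Lemma offsetP a b : exists2 e, (e < n.+2)%N & b = a + e%:R.
Proof. by exists (b - a)%R => //; rewrite natr_Zp addrC subrK. Qed.

Lemma eq_offset a e1 e2 : (e1 < n.+2)%N -> (e2 < n.+2)%N ->
  (a + e1%:R == a + e2%:R) = (e1 == e2).
Proof.
move=> lt1 lt2; rewrite (inj_eq (addrI a)).
by apply/eqP/eqP => [/natrZ_inj|->//]; apply.
Qed.

Lemma offset_pred a : a - 1 = a + n.+1%:R.
Proof.
by have := natrZ_char; rewrite -natr1 => /(canRL (addrK _)) ->; rewrite sub0r.
Qed.

Lemma offset_pred2 a : a - 2%:R = a + n%:R.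
Proof.
have : n%:R + 2%:R = 0 :> V by rewrite -natrD addn2 natrZ_char.
by move=> /(canRL (addrK _)) ->; rewrite sub0r.
Qed.

(** The second alternative is an arc that wraps around past the origin a. *)
Lemma arc_mnmE t a s e : (s < n.+2)%N -> (e < n.+2)%N -> (t <= n.+2)%N ->
  arc_mnm t (a + s%:R) (a + e%:R) =
  ((s <= e < s + t) || (e + n.+2 < s + t))%N.
Proof.
move=> lts lte tn; rewrite mnmE; congr (nat_of_bool _).
have -> : a + e%:R - (a + s%:R) = (e + n.+2 - s)%:R :> V.
  by rewrite natrB; [rewrite natrD natrZ_char; ring|lia].
have [se|se] := leqP s e; last by rewrite val_natrZ; lia.
by rewrite -addnBAC // natrD natrZ_char addr0 val_natrZ; lia.
Qed.

Lemma arc_mnmE0 t a e : (e < n.+2)%N -> arc_mnm t a (a + e%:R) = (e < t)%N.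
Proof.
move=> lte; rewrite mnmE addrC addKr val_natrZ //.
Qed.

Lemma arc_mnm_le1 t a b : (arc_mnm t a b <= 1)%N.
Proof. by rewrite mnmE leq_b1. Qed.

Lemma arc_mnm_but1 a b : arc_mnm n.+1 a b = (b != a - 1).
Proof.
have [e lte ->] := offsetP a b; rewrite arc_mnmE0 // offset_pred eq_offset //.
by congr nat_of_bool; lia.
Qed.

Lemma arc_mnm_but2 a b : arc_mnm n a b = (b != a - 1) && (b != a - 2%:R).
Proof.
have [e lte ->] := offsetP a b.
rewrite arc_mnmE0 // offset_pred offset_pred2 !eq_offset //.
by congr nat_of_bool; lia.
Qed.

(** Sliding an arc by one step trades its first vertex for the vertex that
    follows its last one. *)
Lemma arc_mnm_slide t a : (0 < t < n.+2)%N ->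
  (arc_mnm t a + U_((a + t%:R)%R) = arc_mnm t (a + 1)%R + U_(a))%MM.
Proof.
move=> tn; apply/mnmP=> b; have [e lte ->] := offsetP a b.
rewrite !mnmDE !mnm1E arc_mnmE0 // -[1]/(1%:R) arc_mnmE; [|lia..].
rewrite eq_offset //; last by lia.
have -> : (a == a + e%:R) = (0 == e)%N by rewrite -(@eq_offset a) // addr0.
lia.
Qed.

(** Otherwise a lies strictly after b within the arc of b, and the vertex
    that follows the arc of b belongs to the arc of a. *)
Lemma arc_mnm_antichain t a b : (0 < t < n.+2)%N ->
  (arc_mnm t a <= arc_mnm t b)%MM -> a = b.
Proof.
move=> tn /mnm_lepP le_ab; have [d ltd ad] := offsetP b a.
have [d0|d0] := posnP d; first by rewrite ad d0 addr0.
have := le_ab (b + d%:R); have := le_ab (b + t%:R).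
rewrite ad !arc_mnmE // ?arc_mnmE0 //; lia.
Qed.

(** An arc other than that of a and its two slides contains two consecutive
    vertices outside the arc of a: its first two, or the two that follow the arc
    of a.  This needs arcs and gaps of at least two vertices, that is 1 < t <= n. *)
Lemma arc_mnm_adjacent t a i j : (1 < t <= n)%N ->
  (arc_mnm t i <= arc_mnm t a + U_(j))%MM ->
  [\/ i = a, i = a + 1 /\ j = a + t%:R | i = a - 1 /\ j = a - 1].
Proof.
move=> tn /lepmDU_coord le_ia; have [d ltd id] := offsetP a i.
have jE e : (e < n.+2)%N -> (t <= e)%N -> arc_mnm t i (a + e%:R) = 1%N ->
    j = a + e%:R.
  move=> lte te ie; have := le_ia (a + e%:R).
  by rewrite ie arc_mnmE0 // (leq_gtF te) add0n; case: eqP.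
(* Two consecutive vertices a + e and a + e + 1 of the arc of i outside the arc
   of a would both have to be j. *)
have clash e : (e.+1 < n.+2)%N -> (t <= e)%N -> arc_mnm t i (a + e%:R) = 1%N ->
    arc_mnm t i (a + e.+1%:R) = 1%N -> False.
  move=> lte te /(jE e (ltnW lte) te) je /(jE e.+1 lte (leqW te)).
  by rewrite je => /addrI /natrZ_inj; lia.
have [d0|d0] := posnP d; first by apply: Or31; rewrite id d0 addr0.
have [d1|d1] := eqVneq d 1%N.
  apply: Or32; split; first by rewrite id d1.
  by apply: jE; [lia..|rewrite id arc_mnmE; lia].
have [dn|dn] := eqVneq d n.+1.
  apply: Or33; rewrite offset_pred id dn; split=> //.
  by apply: jE; [lia..|rewrite id arc_mnmE; lia].
exfalso; have [dt|dt] := leqP t d.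
  by apply: (clash d); rewrite ?id ?arc_mnmE; lia.
by apply: (clash t); rewrite ?id ?arc_mnmE; lia.
Qed.

Definition arcs t : 'X_{1..n.+2} -> Prop := fun m => exists a, m = arc_mnm t a.

(** A path is an orbit segment of the successor map, so its first vertex
    determines it. *)
Lemma path_ideal_cycle (k : fieldType) t : (0 < t <= n.+2)%N ->
  ideal_eq (path_ideal (k := k) (@cycle_digraph n.+2) t)
           (monomial_gen (arcs t)).
Proof.
move=> /andP[t0 tn]; apply: ideal_gen_ext => q.
have ordSE a : ordS a = a + 1.
  by apply/val_inj; rewrite /= addn1.
have iterE a e : iter e (@ordS n.+2) a = a + e%:R.
  by elim: e => [|e IH]; rewrite ?addr0 // iterS IH ordSE -addrA -[e.+1]addn1 natrD.
pose arc a := traject (@ordS n.+2) a t.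
have arc_uniq a : uniq (arc a).
  apply/(uniqP a) => e1 e2; rewrite !inE size_traject => lt1 lt2.
  by rewrite !nth_traject // !iterE => /addrI/natrZ_inj; apply; lia.
have arc_prod a : \prod_(b <- arc a) 'X_b = 'X_[arc_mnm t a] :> {mpoly k[n.+2]}.
  rewrite -(big_morph _ (@mpolyXD _ _) (mpolyX0 _ _)); congr 'X_[_].
  apply/mnmP=> b; rewrite mnm_sumE; have [e lte ->] := offsetP a b.
  under eq_bigr => i _ do rewrite mnm1E.
  rewrite arc_mnmE0 // -big_mkcond sum1_count.
  rewrite -(eq_count (a1 := pred1 (a + e%:R))) // count_uniq_mem //.
  congr (nat_of_bool _); apply/trajectP/idP => [[e' lt']|lt]; last by exists e.
  by rewrite iterE => /addrI/natrZ_inj ->; lia.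
split=> [[p /andP[_ sorted_p] ->]|[_ [a ->] ->]].
  have a0 : V := ord0; exists (arc_mnm t (head a0 p)); first by exists (head a0 p).
  rewrite -arc_prod; congr (\prod_(_ <- _) _).
  case: p sorted_p => -[|a s] /= /eqP sz.
    by move=> _; rewrite -sz in t0.
  rewrite /arc -sz /= => path_s; congr cons.
  have /fpathP[m ->] : fpath (@ordS n.+2) a s.
    by apply: sub_path path_s => x y; rewrite /cycle_digraph /= eq_sym.
  by rewrite size_traject.
have szt : size (arc a) == t by rewrite size_traject.
exists (Tuple szt); last by rewrite arc_prod.
rewrite /is_path arc_uniq /arc /=; case: (t) t0 => // t' _ /=.
apply: (sub_path (e := frel (@ordS n.+2))); last exact: fpath_traject.
by move=> x y /eqP <-; rewrite /cycle_digraph.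
Qed.

End Arcs.

(** * Variable decompositions and linear quotients of the arc ideals *)

Section CombinatorialConditions.
Local Open Scope ring_scope.
Variables (n : nat).
Local Notation V := 'I_n.+2.
Implicit Types (a b i j : V).

Variable (k : fieldType).
Local Notation S := {mpoly k[n.+2]}.

Lemma min_gens_arc_subset (A : 'X_{1..n.+2} -> Prop) t : (0 < t < n.+2)%N ->
  (forall m, A m -> arcs t m) ->
  forall m, min_gens (monomial_gen A : S -> Prop) m <-> A m.
Proof.
move=> tn At; apply: min_gens_antichain => u v /At[a ->] /At[b ->].
by move=> /(arc_mnm_antichain tn) ->.
Qed.

(** The arc that starts at l + 2 and its two slides all avoid l, so no
    generator divisible by x_l can be exchanged with it. *)
Lemma not_var_decomp_arcs t : (1 < t < n)%N ->
  ~ var_decomp (monomial_gen (arcs t) : S -> Prop).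
Proof.
move=> tn vdI; have tn2 : (0 < t < n.+2)%N by lia.
have minI := @min_gens_arc_subset (arcs t) t tn2 (fun _ => id).
move: (monomial_gen (arcs t) : S -> Prop) vdI minI => I vdI minI.
have minN l m : min_gens (ideal_nodiv I l) m <-> arcs t m /\ m l = 0%N.
  rewrite (@min_gens_arc_subset _ t tn2) => [|m' [/minI]] //.
  by rewrite minI.
have minD l m : min_gens (ideal_div I l) m <-> arcs t m /\ (0 < m l)%N.
  rewrite (@min_gens_arc_subset _ t tn2) => [|m' [/minI]] //.
  by rewrite minI.
case: vdI minI minN minD => [J u Ju|J l _ xl _ _] minI minN minD.
  have same a : arc_mnm t a = u by apply/Ju/minI; exists a.
  have /(congr1 (fun a : V => nat_of_ord a)) : 0 = 1 :> V.
    by apply: (@arc_mnm_antichain _ t) => //; rewrite !same lepm_refl.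
  by [].
(* Going from l + 2 to l takes n further steps. *)
pose a := l + 2%:R.
have la : l = a + n%:R by rewrite -offset_pred2 addrK.
have [|v /(minD l v)[[b ->] bl]] := xl (arc_mnm t a).
  apply/(minN l); split; first by exists a.
  by rewrite la arc_mnmE0; lia.
move=> /sub_gcd_eqU[] /(@arc_mnm_adjacent _ t); case; first by lia.
- by move=> ba; move: bl; rewrite ba la arc_mnmE0; lia.
- by rewrite la => -[_ /addrI/natrZ_inj]; lia.
by rewrite offset_pred la => -[_ /addrI/natrZ_inj]; lia.
Qed.

(** The vertex a + t follows the arc of a and belongs to the arcs of
    a + 1, ..., a + t, so it splits off the first arc of the interval, and the
    arc of a + 1 provides the exchange. *)
Lemma arc_interval_var_decomp t r a : (0 < t < n.+2)%N -> (0 < r <= t.+1)%N ->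
  var_decomp (monomial_gen (fun m => exists2 s, (s < r)%N & m = arc_mnm t (a + s%:R))
     : S -> Prop).
Proof.
move=> tn; elim: r a => // r IH a rt.
pose itv r a := fun m => exists2 s, (s < r)%N & m = arc_mnm t (a + s%:R).
have minI r' a' := @min_gens_arc_subset (itv r' a') t tn
  (fun _ H => let: ex_intro2 s _ e := H in ex_intro _ _ e).
have val_l s : (s < r.+1)%N -> arc_mnm t (a + s%:R) (a + t%:R) = (s != 0)%N.
  by move=> sr; rewrite arc_mnmE; lia.
have vd1 : var_decomp (monomial_gen (itv 1%N a) : S -> Prop).
  apply: (VarDecompOne (u := arc_mnm t a)) => m; rewrite minI; split=> [[s]|->].
    by case: s => // _ ->; rewrite addr0.
  by exists 0%N; rewrite ?addr0.
case: r => [//|r] in IH rt minI val_l *.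
have eqN : ideal_eq (ideal_nodiv (monomial_gen (itv r.+2 a)) (a + t%:R) : S -> Prop)
                    (monomial_gen (itv 1%N a)).
  apply: monomial_gen_ext => m; rewrite minI; split=> [[[s sr ->]]|[s s0 ->]].
    by rewrite val_l //; case: s sr => // _ _; exists 0%N.
  have -> : s = 0%N by lia.
  by rewrite val_l //; split=> //; exists 0%N.
have eqD : ideal_eq (ideal_div (monomial_gen (itv r.+2 a)) (a + t%:R) : S -> Prop)
                    (monomial_gen (itv r.+1 (a + 1))).
  apply: monomial_gen_ext => m; rewrite minI; split=> [[[s sr ->]]|[s sr ->]].
    rewrite val_l //; case: s sr => // s sr _; exists s => //.
    by rewrite -addrA nat1r.
  by rewrite -addrA nat1r val_l //; split=> //; exists s.+1.
apply: (VarDecompStep (l := a + t%:R)).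
- exists 'X_[arc_mnm t a]; last by rewrite -msupp_eq0 msuppX.
  apply/eqN/mem_monomial_genX; exists (arc_mnm t a); last exact: lepm_refl.
  by exists 0%N; rewrite ?addr0.
- move=> u /(min_gens_ext eqN)/minI[[|//] _ ->]; rewrite addr0.
  exists (arc_mnm t (a + 1)).
    by apply/(min_gens_ext eqD)/minI; exists 0%N; rewrite ?addr0.
  apply/sub_gcd_eqU; split; last by rewrite -[1]/(1%:R) arc_mnmE0 ?arc_mnmE; lia.
  rewrite arc_mnm_slide //; exact: lem_addr.
- by apply: var_decomp_ext vd1 => p; split=> /eqN.
by apply: var_decomp_ext (IH (a + 1) _); [move=> p; split=> /eqD|lia].
Qed.

(** For t = n + 1 the whole cycle of arcs is an interval of length t + 1.  For
    t = n the vertex l = n is avoided exactly by the arcs of 0 and n + 1, which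
    are consecutive; so both parts of the decomposition at x_l are intervals of
    length at most t + 1. *)
Lemma var_decomp_arcs t : (1 < t)%N -> (n <= t < n.+2)%N ->
  var_decomp (monomial_gen (arcs t) : S -> Prop).
Proof.
move=> t1 tn2; have tn : (0 < t < n.+2)%N by lia.
have [tn1|ltt] : t = n.+1 \/ t = n by lia.
  have vdI := @arc_interval_var_decomp t t.+1 0 tn (leqnn t.+1).
  apply: var_decomp_ext vdI => p.
  apply: monomial_gen_ext => m; split=> [[s _ ->]|[a ->]].
    by exists (0 + s%:R).
  have [e lte ->] := offsetP 0 a; exists e => //; lia.
subst t.
have minI := @min_gens_arc_subset (arcs n) n tn (fun _ => id).
pose itv r a := fun m => exists2 s, (s < r)%N & m = arc_mnm n (a + s%:R).
have itv_arcs r a m : itv r a m -> arcs n m by move=> [s _ ->]; exists (a + s%:R).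
have minitv r a := @min_gens_arc_subset (itv r a) n tn (itv_arcs r a).
(* In the coordinates below the arc of e avoids l exactly for e = 0 and
   e = n + 1; these two are listed as n + 1 and (n + 1) + 1 = 0. *)
pose l : V := n%:R.
have val_l e : (e < n.+2)%N -> arc_mnm n (e%:R : V) l = (0 < e < n.+1)%N.
  move=> lte; rewrite -[e%:R]add0r /l -[n%:R]add0r arc_mnmE //; lia.
have val_lN s : (s < 2)%N -> n.+1%:R + s%:R = (if s == 0 then n.+1 else 0)%:R :> V.
  by case: s => [|[|]] // _; rewrite ?addr0 // natr1 natrZ_char.
have eqN : ideal_eq (ideal_nodiv (monomial_gen (arcs n)) l : S -> Prop)
                    (monomial_gen (itv 2%N (n.+1%:R))).
  apply: monomial_gen_ext => m; rewrite minI.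
  split=> [[[a ->]]|[s s2 ->]].
    have [e lte ->] := offsetP 0 a; rewrite add0r val_l // => el.
    have [->|en] : e = 0%N \/ e = n.+1 by lia.
      by exists 1%N; rewrite // val_lN.
    by exists 0%N; rewrite // val_lN // en.
  split; first by exists (n.+1%:R + s%:R).
  by rewrite val_lN //; case: eqP => _; rewrite val_l ?ltnn ?andbF.
have eqD : ideal_eq (ideal_div (monomial_gen (arcs n)) l : S -> Prop)
                    (monomial_gen (itv n (1%:R))).
  apply: monomial_gen_ext => m; rewrite minI.
  split=> [[[a ->]]|[s sn ->]].
    have [e lte ->] := offsetP 0 a; rewrite add0r val_l // => el.
    case: e el {lte} => // e el; exists e; first by lia.
    by rewrite nat1r.
  split; first by exists (1%:R + s%:R).
  by rewrite nat1r val_l //; lia.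
apply: (VarDecompStep (l := l)).
- exists 'X_[arc_mnm n (n.+1%:R : V)]; last by rewrite -msupp_eq0 msuppX.
  apply/eqN/mem_monomial_genX; exists (arc_mnm n n.+1%:R); last exact: lepm_refl.
  by exists 0%N; rewrite ?addr0.
- have divX e : (0 < e < n.+1)%N ->
      min_gens (ideal_div (monomial_gen (arcs n)) l : S -> Prop) (arc_mnm n e%:R).
    move=> en; apply/(min_gens_ext eqD)/minitv; case: e en => // e en.
    by exists e; [lia|rewrite nat1r].
  move=> u /(min_gens_ext eqN)/minitv[s s2 ->]; rewrite val_lN //.
  case: eqP => _.
    exists (arc_mnm n n%:R); first by apply: divX; lia.
    apply/sub_gcd_eqU; split; last by rewrite !val_l; lia.
    have := arc_mnm_slide (n%:R) tn; rewrite natr1 => E.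
    have -> : l = n%:R by [].
    rewrite -E; exact: lem_addr.
  exists (arc_mnm n 1); first by apply: (divX 1%N); lia.
  apply/sub_gcd_eqU; split; last by rewrite (val_l 0%N) ?(val_l 1%N); lia.
  by have := arc_mnm_slide 0 tn; rewrite !add0r => ->; exact: lem_addr.
- have vdI := @arc_interval_var_decomp n 2 n.+1%:R tn ltac:(lia).
  by apply: var_decomp_ext vdI => p; split=> /eqN.
have vdI := @arc_interval_var_decomp n n 1%:R tn ltac:(lia).
by apply: var_decomp_ext vdI => p; split=> /eqD.
Qed.

(** The generators are taken in the order of their first vertices
    0, 1, ..., n + 1.  For t = n + 1 any two generators differ by the exchange of
    one variable.  For t = n the generator of a misses x_(a-1) and x_(a-2):
    the first of these is gained from the arc of a - 1 and divides all earlier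
    generators, except that of a + 1 when this comes earlier, which is reached
    directly through x_(a-2). *)
Lemma linear_quotients_arcs t : (0 < t < n.+2)%N -> (n <= t)%N ->
  has_linear_quotients (monomial_gen (arcs t) : S -> Prop).
Proof.
move=> tn tn2; split; first by exists (arcs t).
have arc_inj : injective (@arc_mnm n t).
  by move=> a b ab; apply: (arc_mnm_antichain tn); rewrite ab lepm_refl.
exists (map (@arc_mnm n t) (enum V)); split.
- by rewrite map_inj_uniq // enum_uniq.
- move=> m; rewrite (@min_gens_arc_subset _ t tn (fun _ => id)).
  split=> [/mapP[a _ ->]|[a ->]]; first by exists a.
  by rewrite map_f // mem_enum.
move=> i; rewrite size_map size_enum_ord => /andP[i0 lti].
have mem_take m : reflect (exists2 b : V, (b < i)%N & m = arc_mnm t b)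
    (m \in take i (map (@arc_mnm n t) (enum V))).
  have takeE b : (arc_mnm t b \in take i (map (@arc_mnm n t) (enum V))) = (b < i)%N.
    by rewrite in_take ?map_f ?mem_enum // index_map // index_enum_ord.
  apply: (iffP idP) => [mi|[b bi ->]]; last by rewrite takeE.
  have /mapP[b _ mb] := mem_take mi.
  by exists b; rewrite // -takeE -mb.
pose a : V := Ordinal lti.
have -> : nth 0%MM (map (@arc_mnm n t) (enum V)) i = arc_mnm t a.
  by rewrite (nth_map a) ?size_enum_ord // -[i]/(nat_of_ord a) nth_ord_enum.
apply/colon_variablesP => _ /mem_take[b bi ->].
have ba : b != a by apply: contraTneq bi => ->; rewrite ltnn.
have pred_i : (a - 1 : V) = i.-1 :> nat.
  have -> : a = i.-1%:R + 1 by rewrite natr1 prednK // -[i]/(nat_of_ord a) natr_Zp.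
  by rewrite addrK val_natrZ //; lia.
have [tn1|tn1] : t = n.+1 \/ t = n by lia.
  subst t; exists (a - 1); first by rewrite !arc_mnm_but1 eqxx (inj_eq (addIr _)) eq_sym ba.
  exists (arc_mnm n.+1 b); first by apply/mem_take; exists b.
  apply/mnm_lepP=> x; rewrite mnmDE mnm1E !arc_mnm_but1 (eq_sym x (a - 1)).
  by case: (a - 1 == x); case: (x == b - 1).
subst t; have sub12 c : c - 1 - 1 = c - 2%:R :> V by ring.
have [b_next|b_next] := eqVneq b (a + 1).
  exists (a - 2%:R).
    rewrite !arc_mnm_but2 eqxx andbF b_next addrK offset_pred2.
    have -> : a + 1 - 2%:R = a + n.+1%:R by rewrite -offset_pred; ring.
    by rewrite -{2}[a]addr0 -[0]/(0%:R) !eq_offset //; lia.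
  exists (arc_mnm n b); first by apply/mem_take; exists b.
  by rewrite b_next offset_pred2 arc_mnm_slide //; apply: lem_addr.
exists (a - 1).
  rewrite !arc_mnm_but2 eqxx (inj_eq (addIr _)) (eq_sym a) ba /=.
  suff -> : (a - 1 == b - 2%:R) = (b == a + 1) by rewrite b_next.
  apply/eqP/eqP => [E|->]; last by ring.
  have -> : b = (b - 2%:R) + 2%:R by ring.
  by rewrite -E; ring.
exists (arc_mnm n (a - 1)); first by apply/mem_take; exists (a - 1); rewrite // pred_i; lia.
by have := arc_mnm_slide (a - 1) tn; rewrite subrK => <-; apply: lem_addr.
Qed.

(** Let u_c be the last generator in the order.  Of its neighbours let u_a
    be the later and u_b the earlier.  The only neighbour of u_a that can precede
    it is the one away from c, and the variable gained from that one does not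
    divide u_b when t < n. *)
Lemma not_linear_quotients_arcs t : (1 < t < n)%N ->
  ~ has_linear_quotients (monomial_gen (arcs t) : S -> Prop).
Proof.
move=> tn [_ [v [_ vP lq]]]; have tn2 : (0 < t < n.+2)%N by lia.
have {}vP m : m \in v <-> arcs t m.
  by rewrite vP (@min_gens_arc_subset _ t tn2 (fun _ => id)).
have arc_inj : injective (@arc_mnm n t).
  by move=> a b ab; apply: (arc_mnm_antichain tn2); rewrite ab lepm_refl.
have arc_v a : arc_mnm t a \in v by apply/vP; exists a.
pose pos a := index (arc_mnm t a) v.
have step a b : (pos b < pos a)%N -> exists2 l,
    (arc_mnm t a l < arc_mnm t b l)%N & exists2 i,
    (pos i < pos a)%N & (arc_mnm t i <= arc_mnm t a + U_(l))%MM.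
  move=> ba; have /colon_variablesP : exists W : {set V},
      ideal_eq (colon (monomial_gen (fun m => m \in take (pos a) v)) 'X_[arc_mnm t a] : S -> Prop)
               (variable_gen W).
    have := lq (pos a); rewrite nth_index //; apply.
    by rewrite index_mem arc_v (leq_ltn_trans _ ba).
  move=> /(_ (arc_mnm t b)); rewrite in_take // => /(_ ba)[l ab [w wv le]].
  have /vP[i iw] := mem_take wv; subst w.
  by exists l => //; exists i => //; rewrite in_take in wv.
(* c is the last generator; the two cases say which of its neighbours is later. *)
have [c _ cmax] := @arg_maxnP V 0 predT pos isT.
have {}cmax b : (pos b <= pos c)%N := cmax b isT.
have [|le] := ltnP (pos (c - 1)) (pos (c + 1)).
  case/step=> l lab [i ia /(@arc_mnm_adjacent _ t)[|ia'|[ia' la]|[ia' la]]]; first by lia.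
  - by rewrite ia' ltnn in ia.
  - move: lab; have -> : l = (c - 1) + t.+2%:R by rewrite la -natr1 -natr1; ring.
    by rewrite arc_mnmE0; lia.
  by move: ia; rewrite ia' addrK ltnNge cmax.
have neq : c + 1 != c - 1.
  by rewrite offset_pred -[1]/(1%:R) eq_offset //; lia.
have : (pos (c + 1)%R < pos (c - 1)%R)%N.
  rewrite ltn_neqAle le andbT; apply: contraNneq neq => posE.
  apply/eqP/arc_inj; rewrite -(nth_index 0%MM (arc_v (c + 1)%R)).
  by rewrite -[index _ _]/(pos _) posE nth_index.
case/step=> l lab [i ia /(@arc_mnm_adjacent _ t)[|ia'|[ia' la]|[ia' la]]]; first by lia.
- by rewrite ia' ltnn in ia.
- by move: ia; rewrite ia' subrK ltnNge cmax.
move: lab; have -> : l = (c + 1) + n.-1%:R.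
  have -> : l = c - 2%:R by rewrite la; ring.
  by rewrite offset_pred2 -addrA nat1r prednK //; lia.
by rewrite arc_mnmE0; lia.
Qed.

End CombinatorialConditions.

(** * Long gaps: the second syzygies are not linear *)

Section SlideRelations.
Local Open Scope ring_scope.
Variables (k : fieldType) (n : nat).
Local Notation V := 'I_n.+2.
Local Notation S := {mpoly k[n.+2]}.
Implicit Types (a b i j : V).

Lemma arc_mnmS t a : (t < n.+2)%N ->
  arc_mnm t.+1 a = (arc_mnm t a + U_((a + t%:R)%R))%MM.
Proof.
move=> tn; apply/mnmP=> b; have [e lte ->] := offsetP a b.
by rewrite mnmDE mnm1E !arc_mnmE0 // eq_offset //; lia.
Qed.

Lemma mdeg_arc t a : (t <= n.+2)%N -> mdeg (arc_mnm t a) = t.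
Proof.
elim: t => [|t IH] tn; last by rewrite arc_mnmS // mdegD mdeg1 IH ?addn1 // ltnW.
by apply/eqP; rewrite mdeg_eq0; apply/eqP/mnmP => b; rewrite !mnmE.
Qed.

Definition arc_col t : 'cV[S]_n.+2 := monomial_col k (@arc_mnm n t).

(** Row i is the relation x_i u_(i+1) = x_(i+t) u_i. *)
Definition slide_mx t : 'M[S]_n.+2 :=
  \matrix_(i, j) ('X_i *+ (j == i + 1) - 'X_(i + t%:R) *+ (j == i)).

Lemma slide_mx_homog t : mx_homog 1 (slide_mx t).
Proof.
by move=> i j; rewrite mxE; apply: rpredB; apply: rpredMn; rewrite dhomogX /= mdeg1.
Qed.

Lemma mul_slide_mx t (l : 'rV[S]_n.+2) j :
  (l *m slide_mx t) ord0 j = l ord0 (j - 1) * 'X_(j - 1) - l ord0 j * 'X_(j + t%:R).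
Proof.
rewrite mxE; under eq_bigr => i _ do rewrite mxE mulrBr !mulrnAr !mulrb.
rewrite sumrB -!big_mkcond /= (big_pred1 (j - 1)); last first.
  by move=> i; rewrite /= [RHS]eq_sym subr_eq.
by rewrite (big_pred1 j) // => i; rewrite /= eq_sym.
Qed.

Lemma slide_mx_arc_col t : (0 < t < n.+2)%N -> slide_mx t *m arc_col t = 0.
Proof.
move=> tn; apply/matrixP=> i j; rewrite !mxE.
under eq_bigr => a _ do rewrite !mxE mulrBl !mulrnAl !mulrb.
rewrite sumrB -!big_mkcond /= big_pred1_eq big_pred1_eq.
by rewrite -!mpolyXD ![(U_(_) + _)%MM]addmC -arc_mnm_slide // subrr.
Qed.

(** The slides span the linear relations between the generators, and
    admit no linear relation between them, but the complements of the arcs of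
    length t + 1 give a relation of degree n + 1 - t between them. *)
Lemma not_linear_resolution_arcs t : (1 < t < n)%N ->
  ~ has_linear_resolution (monomial_gen (arcs t) : S -> Prop).
Proof.
move=> tn lres; have tn2 : (0 < t < n.+2)%N by lia.
have nt a : a + t%:R != a - 1.
  by rewrite offset_pred eq_offset; lia.
have nt1 a : a - 1 != a + 1 + t%:R.
  by rewrite -addrA nat1r offset_pred eq_offset; lia.
have indep (c : 'rV[S]_n.+2) : mx_homog 0 c -> c *m arc_col t = 0 -> c = 0.
  move=> hc /monomial_col_eq0 c0; apply/rowP=> a; rewrite mxE; apply/mpolyP => m.
  rewrite mcoeff0; have [m0|m0] := eqVneq (mdeg m) 0%N; last first.
    exact: dhomog_nemf_coeff (hc ord0 a) m0.
  have {m m0}-> : m = 0%MM by apply/eqP; rewrite -mdeg_eq0 m0.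
  move: c0 => /(congr1 (mcoeff (arc_mnm t a))).
  rewrite mcoeff0 raddf_sum (bigD1 a) //= mcoeffMXE lepm_refl.
  have -> : (arc_mnm t a - arc_mnm t a = 0)%MM.
    by apply/mnmP=> b; rewrite mnmBE mnm0E subnn.
  rewrite big1 ?addr0 // => b ba; rewrite mcoeffMXE ifN //.
  by apply: contra ba => /(arc_mnm_antichain tn2) ->.
(* The coefficient of x_j u_a in a linear relation involves u_a alone, unless
   x_j u_a is also a multiple of a neighbour of u_a. *)
have linsyz (l : 'rV[S]_n.+2) : mx_homog 1 l -> l *m arc_col t = 0 ->
    exists c, l = c *m slide_mx t.
  move=> hl /monomial_col_eq0 l0.
  have coef a j : \sum_b (if (arc_mnm t b <= arc_mnm t a + U_(j))%MM then
      (l ord0 b)@_(arc_mnm t a + U_(j) - arc_mnm t b) else 0) = 0.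
    move: l0 => /(congr1 (mcoeff (arc_mnm t a + U_(j))%MM)).
    rewrite mcoeff0 raddf_sum /= => E; rewrite -[RHS]E.
    by apply: eq_bigr => b _; rewrite mcoeffMXE.
  have subU a j : (arc_mnm t a + U_(j) - arc_mnm t a = U_(j))%MM.
    by rewrite addmC addmK.
  have coef0 a j : j != a + t%:R -> j != a - 1 -> (l ord0 a)@_U_(j) = 0.
    move=> j1 j2; have := coef a j.
    rewrite (bigD1 a) //= lem_addr subU big1 ?addr0 // => b ba.
    case: ifP => // /(@arc_mnm_adjacent _ t)[|/eqP|[_ /eqP]|[_ /eqP]]; first by lia.
    - by rewrite (negPf ba).
    - by rewrite (negPf j1).
    by rewrite (negPf j2).
  have coef2 a : (l ord0 a)@_U_(a + t%:R) + (l ord0 (a + 1))@_U_(a) = 0.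
    have := coef a (a + t%:R).
    have a1 : a + 1 != a by rewrite -{2}[a]addr0 (inj_eq (addrI a)).
    rewrite (bigD1 a) //= lem_addr subU (bigD1 (a + 1)) //= arc_mnm_slide //.
    rewrite lem_addr subU big1 ?addr0 // => b /andP[ba ba1].
    rewrite -arc_mnm_slide //.
    case: ifP => // /(@arc_mnm_adjacent _ t)[|/eqP|[/eqP + _]|[_ /eqP]]; first by lia.
    - by rewrite (negPf ba).
    - by rewrite (negPf ba1).
    by rewrite (negPf (nt a)).
  exists (\row_a (- (l ord0 a)@_U_(a + t%:R))%:MP); apply/rowP => a.
  apply: linear_form_eq => [|| j]; first exact: hl.
    have hc : mx_homog 0 (\row_a (- (l ord0 a)@_U_(a + t%:R))%:MP : 'rV[S]_n.+2).
      move=> o b; rewrite mxE -[_%:MP]mulr1 mul_mpolyC; apply: rpredZ.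
      exact: dhomog1.
    exact: (mx_homogM hc (slide_mx_homog t)).
  rewrite mul_slide_mx !mxE mcoeffB !mcoeffCM !mcoeffX !eq_mnm1.
  have [->|ja] := eqVneq j (a - 1).
    rewrite (negPf (nt a)) mulr1 mulr0 subr0.
    by have := coef2 (a - 1); rewrite subrK => /(canRL (addKr _)) ->; rewrite addr0.
  rewrite mulr0 sub0r.
  have [->|jt] := eqVneq j (a + t%:R); first by rewrite mulr1 opprK.
  by rewrite mulr0 oppr0 coef0.
(* Comparing entries in two consecutive columns, each coefficient would be
   divisible by two distinct variables. *)
have nolin (l : 'rV[S]_n.+2) : mx_homog 1 l -> l *m slide_mx t = 0 -> l = 0.
  move=> hl l0; have rel j : l ord0 (j - 1) * 'X_(j - 1) = l ord0 j * 'X_(j + t%:R).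
    by apply/eqP; rewrite -subr_eq0 -mul_slide_mx l0 mxE.
  apply/rowP=> a; rewrite mxE; apply/eqP; rewrite -msupp_eq0.
  case E: (msupp _) => [//|m s]; have ma : m \in msupp (l ord0 a) by rewrite E mem_head.
  have m1 : (0 < m (a - 1)%R)%N by apply: (dvdX_mulX (nt a) (esym (rel a)) ma).
  have m2 : (0 < m (a + 1 + t%:R)%R)%N.
    have := rel (a + 1); rewrite addrK => rel1.
    apply: (dvdX_mulX _ rel1 ma); rewrite -addrA nat1r -{1}[a]addr0.
    by rewrite -[0]/(0%:R) eq_offset; lia.
  have : mdeg m = 1%N by apply: (dhomog_mf (hl ord0 a)).
  move=> /eqP/mdeg1P[x /eqP mx]; move: m1 m2; rewrite mx !mnm1E.
  by case: eqP => [->|//] _; rewrite (negPf (nt1 a)).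
(* m a is the complement of the arc of length t + 1 at a. *)
pose m a : 'X_{1..n.+2} := [multinom (1 - arc_mnm t.+1 a b)%N | b < n.+2].
pose v : 'rV[S]_n.+2 := \row_a 'X_[m a].
suff /matrixP/(_ ord0 ord0) : v = 0.
  by rewrite !mxE => /eqP; rewrite (negPf (mpolyX_neq0 _ _)).
apply: (linear_resolution_no_second_syzygies (t := t) _ _ _ _ _ indep _ linsyz nolin lres) => //.
- by apply: monomial_col_homog => a; apply: mdeg_arc; lia.
- exact: slide_mx_homog.
- by move=> p; apply: monomial_gen_col.
- exact: slide_mx_arc_col.
apply/rowP=> a; rewrite mul_slide_mx !mxE -!mpolyXD; apply/eqP; rewrite subr_eq0.
apply/eqP; congr 'X_[_]; apply/mnmP=> b.
have tS : (0 < t.+1 < n.+2)%N by lia.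
have := arc_mnm_slide (a - 1) tS; rewrite subrK => /mnmP/(_ b).
have -> : a - 1 + t.+1%:R = a + t%:R by rewrite -natr1; ring.
have mE c : m c b = (1 - arc_mnm t.+1 c b)%N by rewrite mnmE.
rewrite !mnmDE !mE.
have := arc_mnm_le1 t.+1 a b; have := arc_mnm_le1 t.+1 (a - 1) b; lia.
Qed.

End SlideRelations.

(** * Short gaps: explicit linear resolutions *)

Section LinearResolutions.
Local Open Scope ring_scope.
Variables (k : fieldType) (n : nat).
Local Notation V := 'I_n.+2.
Local Notation S := {mpoly k[n.+2]}.
Implicit Types (a b : V).

(** The generator of a is the only one that avoids x_(a-1), so this variable
    divides v a.  What is left is the sum of the quotients c a, times the product of
    all variables. *)
Lemma syzygy_but1 (v : V -> S) :
  \sum_a v a * 'X_[arc_mnm n.+1 a] = 0 ->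
  exists2 c : V -> S, forall a, v a = c a * 'X_(a - 1) & \sum_a c a = 0.
Proof.
move=> v0; have [c vc] : exists c : V -> S, forall a, v a = c a * 'X_(a - 1).
  apply: (fin_all_exists (P := fun a c => v a = c * 'X_(a - 1))) => a.
  apply: dvdX_factor => m /(syzygy_support v0)[b ba /mnm_lepP/(_ (a - 1))].
  rewrite mnmDE !arc_mnm_but1 eqxx addn0 (inj_eq (addIr _)) eq_sym.
  by rewrite ba.
exists c => //; move: v0; have E a : v a * 'X_[arc_mnm n.+1 a] = c a * 'X_[arc_mnm n.+2 0].
  rewrite vc -mulrA -mpolyXD; congr (_ * 'X_[_]); apply/mnmP=> b.
  rewrite mnmDE mnm1E arc_mnm_but1 eq_sym.
  by have [e lte ->] := offsetP 0 b; rewrite arc_mnmE0 // lte; case: eqP.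
under eq_bigr => a _ do rewrite E.
by move/eqP; rewrite -mulr_suml mulf_eq0 (negPf (mpolyX_neq0 _ _)) orbF => /eqP.
Qed.

(** All the generators coincide with the product of all variables, so the
    ideal is free of rank one. *)
Lemma linear_resolution_arcs_n2 :
  has_linear_resolution (monomial_gen (@arcs n n.+2) : S -> Prop).
Proof.
pose f (_ : 'I_1) := arc_mnm n.+2 (0 : V).
have arcE a : arc_mnm n.+2 a = f ord0.
  by apply/mnmP=> b; rewrite !mnmE !ltn_ord.
have fE p : monomial_gen (@arcs n n.+2) p <->
    monomial_gen (fun m => exists i : 'I_1, m = f i) (p : S).
  by apply: monomial_gen_ext => m; split=> [[a ->]|[i ->]];
     [exists ord0; rewrite arcE|exists 0].
apply: (@has_linear_resolution_length2 k n.+2 _ n.+2 1 0 0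
          (monomial_col k f) 0 0).
- by apply: monomial_col_homog => i; rewrite mdeg_arc.
- by case.
- by case.
- by move=> p; rewrite fE; apply: monomial_gen_col.
- by rewrite mul0mx.
- by rewrite mul0mx.
- move=> v /monomial_col_eq0; rewrite big_ord1 => /eqP.
  rewrite mulf_eq0 (negPf (mpolyX_neq0 _ _)) orbF => /eqP v0; exists 0.
  by apply/rowP=> i; rewrite mul0mx mxE ord1.
- by move=> v _; exists 0; rewrite (thinmx0 v) mul0mx.
by move=> v _; rewrite (thinmx0 v).
Qed.

(** By [syzygy_but1] the relations are the families (c_a x_(a-1)) with
    sum c_a = 0, which have the basis x_(a-1) e_a - x_(-1) e_0 for a <> 0. *)
Lemma linear_resolution_arcs_n1 :
  has_linear_resolution (monomial_gen (@arcs n n.+1) : S -> Prop).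
Proof.
pose D0 : 'M[S]_(n.+1, n.+2) := \matrix_(i, j)
  ('X_(j - 1) *+ (j == lift ord0 i) - 'X_(0 - 1) *+ (j == ord0)).
have mulD0 (w : 'rV[S]_n.+1) i : (w *m D0) ord0 (lift ord0 i) = w ord0 i * 'X_(lift ord0 i - 1).
  rewrite mxE (bigD1 i) //= mxE eqxx mulr1n mulr0n subr0 big1 ?addr0 // => i' i'i.
  by rewrite mxE (inj_eq lift_inj) eq_sym (negPf i'i) mulr0n subr0 mulr0.
have mulD00 (w : 'rV[S]_n.+1) : (w *m D0) ord0 ord0 = - ((\sum_i w ord0 i) * 'X_(0 - 1)).
  rewrite mxE mulr_suml -sumrN; apply: eq_bigr => i _.
  by rewrite mxE eqxx mulr1n mulr0n sub0r mulrN.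
apply: (@has_linear_resolution_length2 k n.+2 _ n.+1 n.+2 n.+1 0
          (arc_col k n n.+1) D0 0).
- by apply: monomial_col_homog => a; rewrite mdeg_arc.
- by move=> i j; rewrite mxE; apply: rpredB; apply: rpredMn; rewrite dhomogX /= mdeg1.
- by case.
- by move=> p; apply: monomial_gen_col.
- apply/row_matrixP=> i; rewrite row_mul row0; apply/monomial_col_eq0.
  rewrite big_ord_recl (bigD1 i) //= big1 ?addr0 => [|j ji].
    rewrite !mxE !eqxx !mulr0n !mulr1n subr0 sub0r mulNr -!mpolyXD addrC.
    apply/eqP; rewrite subr_eq0; apply/eqP; congr 'X_[_]; apply/mnmP=> b.
    by rewrite !mnmDE !mnm1E !arc_mnm_but1 !(eq_sym b); case: eqP; case: eqP.
  by rewrite !mxE (inj_eq lift_inj) (negPf ji) !mulr0n subr0 mul0r.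
- by rewrite mul0mx.
- move=> v /monomial_col_eq0/syzygy_but1[c vc c0].
  exists (\row_i c (lift ord0 i)); apply/rowP=> j.
  have [i ->|->] := unliftP ord0 j; first by rewrite mulD0 mxE vc.
  rewrite mulD00 vc; move: c0; rewrite big_ord_recl => /(canRL (addrK _)) ->.
  rewrite sub0r mulNr; congr (- (_ * _)).
  by apply: eq_bigr => i _; rewrite mxE.
- move=> v /rowP v0; exists 0; rewrite mul0mx; apply/rowP=> i.
  have /eqP := v0 (lift ord0 i); rewrite mulD0 !mxE mulf_eq0.
  by rewrite (negPf (mpolyX_neq0 _ _)) orbF => /eqP.
by move=> v _; rewrite (thinmx0 v).
Qed.

(** Partial sums give a primitive on the line 0, ..., n + 1; it closes up
    around the cycle because the total sum vanishes. *)
Lemma cyclic_primitive (G : zmodType) (d : V -> G) : \sum_a d a = 0 ->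
  exists s : V -> G, forall a, s (a - 1) - s a = d a.
Proof.
move=> d0; exists (fun a => - \sum_(b : V | (b <= a)%N) d b) => a.
rewrite opprK addrC; have [a0|a_gt0] := posnP a.
  have -> : a = 0 by apply/val_inj.
  rewrite (big_pred1 0) => [|b]; last by rewrite /= -val_eqE /= leqn0.
  rewrite (eq_bigl predT) ?d0 ?subr0 // => b.
  by rewrite offset_pred add0r val_natrZ // -ltnS ltn_ord.
have pred_a : (a - 1 : V) = a.-1 :> nat.
  have {1}-> : a = a.-1%:R + 1 by rewrite natr1 prednK // natr_Zp.
  by rewrite addrK val_natrZ //; have := ltn_ord a; lia.
rewrite (bigD1 a) //= (eq_bigl (fun b : V => b <= (a - 1)%R)%N) ?addrK // => b.
by rewrite pred_a -val_eqE /=; lia.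
Qed.

(** The differentials are the slides and the row of the x_(i-1).

    Exactness at the generators: in a relation, v_a = al_a x_(a-1) + be_a x_(a-2)
    because every other generator contains one of these two variables.
    Multiplying out, al_(a+1) + be_a is a relation between the arcs of length
    n + 1, hence of the form dl_a x_(a-1) with sum dl_a = 0.  Writing dl as a
    cyclic difference of ep, the combination of slides with coefficients
    al_(a+1) + ep_a x_(a-1) is v.

    Exactness at the slides: a relation v satisfies
    v_(j-1) x_(j-1) = v_j x_(j-2), so x_(j-1) divides v_j and the quotient does
    not depend on j. *)
Lemma linear_resolution_arcs_n : (1 < n)%N ->
  has_linear_resolution (monomial_gen (@arcs n n) : S -> Prop).
Proof.
move=> n1; have tn : (0 < n < n.+2)%N by lia.
have offn a : a + n%:R = a - 2%:R by rewrite offset_pred2.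
have a12 a : a - 1 != a - 2%:R.
  by rewrite offset_pred offset_pred2 eq_offset //; lia.
pose D1 : 'rV[S]_n.+2 := \row_i 'X_(i - 1).
have sub12 a : a - 1 - 1 = a - 2%:R by ring.
have D1s : D1 *m slide_mx k n n = 0.
  apply/rowP=> j; rewrite mul_slide_mx offn !mxE sub12.
  by rewrite mulrC subrr.
have X0 i : 'X_i != 0 :> S := mpolyX_neq0 _ _.
apply: (@has_linear_resolution_length2 k n.+2 _ n n.+2 n.+2 1
          (arc_col k n n) (slide_mx k n n) D1).
- by apply: monomial_col_homog => a; rewrite mdeg_arc //; lia.
- exact: slide_mx_homog.
- by move=> i j; rewrite mxE dhomogX /= mdeg1.
- by move=> p; apply: monomial_gen_col.
- exact: slide_mx_arc_col.
- exact: D1s.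
- move=> v /monomial_col_eq0 v0.
  have [al [be vE]] : exists al be : V -> S,
      forall a, v ord0 a = al a * 'X_(a - 1) + be a * 'X_(a - 2%:R).
    have [f fE] : exists f : V -> S * S, forall a,
        v ord0 a = (f a).1 * 'X_(a - 1) + (f a).2 * 'X_(a - 2%:R).
      apply: (fin_all_exists (P := fun a (c : S * S) =>
        v ord0 a = c.1 * 'X_(a - 1) + c.2 * 'X_(a - 2%:R))) => a.
      have [m /(syzygy_support v0)[b ba /mnm_lepP le]|c [d ->]] :=
          @dvdX2_factor k n.+2 (v ord0 a) _ _ (a12 a); last by exists (c, d).
      have := le (a - 1); have := le (a - 2%:R).
      rewrite !mnmDE !arc_mnm_but2 !eqxx !andbF !addn0 /=.
      rewrite !(inj_eq (addIr _)) [a == b]eq_sym (negPf ba) /= andbT.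
      have [E|] := eqVneq (a - 2%:R) (b - 1); last by move=> _ ->; rewrite orbT.
      move=> _; have [E'|] := eqVneq (a - 1) (b - 2%:R); last by move=> _ ->.
      have : a - 1 == a - 1 - 2%:R by rewrite {1}E' -[b](subrK 1) -E; apply/eqP; ring.
      by rewrite offset_pred2 -{1}[a - 1]addr0 -[0]/(0%:R) eq_offset //; lia.
    by exists (fun a => (f a).1), (fun a => (f a).2).
  have [|dl gaE sum_dl] := @syzygy_but1 (fun a => al (a + 1) + be a).
    rewrite -[RHS]v0; under [RHS]eq_bigr => a _ do rewrite vE mulrDl.
    rewrite /=; under eq_bigr => a _ do rewrite mulrDl.
    rewrite !big_split /=; congr (_ + _); last first.
      apply: eq_bigr => a _; rewrite -mulrA -mpolyXD; congr (_ * 'X_[_]).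
      by rewrite arc_mnmS // offn addmC.
    rewrite [RHS](reindex_inj (addIr 1)) /=; apply: eq_bigr => a _.
    rewrite addrK -mulrA -mpolyXD; congr (_ * 'X_[_]).
    by rewrite arc_mnmS // arc_mnm_slide // addmC.
  have [ep epE] := cyclic_primitive sum_dl.
  exists (\row_a (al (a + 1) + ep a * 'X_(a - 1))); apply/rowP=> a.
  rewrite mul_slide_mx !mxE offn subrK vE.
  have -> : be a = dl a * 'X_(a - 1) - al (a + 1) by rewrite -gaE addrC addKr.
  by rewrite -epE sub12; ring.
- move=> v vs; have rel j : v ord0 (j - 1) * 'X_(j - 1) = v ord0 j * 'X_(j - 2%:R).
    by apply/eqP; rewrite -subr_eq0 -offn -mul_slide_mx vs mxE.
  have [c vc] : exists c : V -> S, forall a, v ord0 a = c a * 'X_(a - 1).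
    apply: (fin_all_exists (P := fun a c => v ord0 a = c * 'X_(a - 1))) => a.
    apply: dvdX_factor; apply: (dvdX_mulX _ (esym (rel a))).
    by rewrite eq_sym.
  have c_pred a : c (a - 1) = c a.
    have := rel a; rewrite !vc sub12 mulrAC => /(mulIf (X0 _)) /(mulIf (X0 _)).
    by [].
  exists (c 0)%:M; apply/rowP=> a; rewrite mul_scalar_mx !mxE vc; congr (_ * _).
  have [e _ ->] := offsetP 0 a; elim: e => [|e IH]; first by rewrite addr0.
  by rewrite -c_pred -natr1 addrA addrK.
move=> v /rowP/(_ 0)/eqP; rewrite !mxE big_ord1 mxE mulf_eq0 (negPf (X0 _)) orbF.
by move=> /eqP v0; apply/rowP=> i; rewrite mxE ord1.
Qed.

End LinearResolutions.

(** * Path ideals of the cycle *)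

Section Classification.
Local Open Scope ring_scope.
Variables (k : fieldType).

Lemma min_gens_arcs_n2 n (m : 'X_{1..n.+2}) :
  min_gens (monomial_gen (@arcs n n.+2) : {mpoly k[n.+2]} -> Prop) m <->
  m = arc_mnm n.+2 0.
Proof.
have arcE (a : 'I_n.+2) : arc_mnm n.+2 a = arc_mnm n.+2 0.
  by apply/mnmP=> b; rewrite !mnmE !ltn_ord.
rewrite min_gens_antichain => [|u v [a ->] [b ->] _]; last by rewrite !arcE.
by split=> [[a ->]|->]; [rewrite arcE|exists 0].
Qed.

Lemma var_decomp_arcs_n2 n :
  var_decomp (monomial_gen (@arcs n n.+2) : {mpoly k[n.+2]} -> Prop).
Proof. exact: VarDecompOne (@min_gens_arcs_n2 n). Qed.

Lemma linear_quotients_arcs_n2 n :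
  has_linear_quotients (monomial_gen (@arcs n n.+2) : {mpoly k[n.+2]} -> Prop).
Proof.
split; first by exists (arcs n.+2).
exists [:: arc_mnm n.+2 0]; split=> // [m|[|[]]//].
by rewrite min_gens_arcs_n2 inE; split=> /eqP.
Qed.

Lemma path_ideal_linear n t (I := path_ideal (k := k) (@cycle_digraph n.+2) t) :
  (1 < t <= n.+2)%N -> (n <= t)%N ->
  [/\ has_linear_resolution I, variable_decomposable I & has_linear_quotients I].
Proof.
move=> t1 tn; have EI : ideal_eq (monomial_gen (arcs t)) I.
  have t0 : (0 < t <= n.+2)%N by lia.
  by move=> p; split=> /(@path_ideal_cycle n k t t0).
have sqfree : squarefree_monomial_ideal I.
  exists (arcs t) => [p|_ [a ->] i]; last exact: arc_mnm_le1.
  by split=> /EI.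
suff [lr vd lq] : [/\ has_linear_resolution (monomial_gen (@arcs n t) : {mpoly k[n.+2]} -> Prop),
    var_decomp (monomial_gen (@arcs n t) : {mpoly k[n.+2]} -> Prop) &
    has_linear_quotients (monomial_gen (@arcs n t) : {mpoly k[n.+2]} -> Prop)].
  split; [exact: has_linear_resolution_ext lr| |exact: has_linear_quotients_ext lq].
  by split=> //; apply: var_decomp_ext vd.
have [-> | [t_lt tE]] : t = n.+2 \/ (0 < t < n.+2)%N /\ (t = n \/ t = n.+1) by lia.
  split; [exact: linear_resolution_arcs_n2|exact: var_decomp_arcs_n2|].
  exact: linear_quotients_arcs_n2.
split; [|by apply: var_decomp_arcs; lia|by apply: linear_quotients_arcs].
case: tE t1 => -> t1; last exact: linear_resolution_arcs_n1.
by apply: linear_resolution_arcs_n; lia.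
Qed.

Lemma path_ideal_not_linear n t (I := path_ideal (k := k) (@cycle_digraph n.+2) t) :
  (1 < t < n)%N ->
  [/\ ~ has_linear_resolution I, ~ variable_decomposable I & ~ has_linear_quotients I].
Proof.
move=> tn; have t0 : (0 < t <= n.+2)%N by lia.
have EI := @path_ideal_cycle n k t t0.
split.
- by move/(has_linear_resolution_ext EI); apply: not_linear_resolution_arcs.
- by case=> _ /(var_decomp_ext EI); apply: not_var_decomp_arcs.
by move/(has_linear_quotients_ext EI); apply: not_linear_quotients_arcs.
Qed.

End Classification.

Theorem corollary3p4 (k : fieldType) (n t : nat) (ht : 2 <= t) (htn : t <= n) :
  (t < n ->
     (has_linear_resolution (path_ideal (k := k) (@cycle_digraph n) t)
        <-> t = n - 2 \/ t = n - 1)) /\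
  (t = n ->
     has_linear_resolution (path_ideal (k := k) (@cycle_digraph n) t)) /\
  (has_linear_resolution (path_ideal (k := k) (@cycle_digraph n) t)
     <-> variable_decomposable (path_ideal (k := k) (@cycle_digraph n) t)) /\
  (variable_decomposable (path_ideal (k := k) (@cycle_digraph n) t)
     <-> has_linear_quotients (path_ideal (k := k) (@cycle_digraph n) t)).
Proof.
case: n htn => [|[|n]] htn; [lia..|].
have [tn|tn] := ltnP t n.
  have [|lr vd lq] := @path_ideal_not_linear k n t; first by rewrite ht.
  by split; [move=> _; split=> // H; lia|split; [lia|]].
have [|//|lr vd lq] := @path_ideal_linear k n t; first by rewrite ht.
by split; [move=> tn2; split=> // _; lia|].
Qed.
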